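(* Let $n,m\ge1$ and let $\phi:\mathbb{R}_+^n\to\mathbb{R}_+$ be a symmetric form that is Hölder and concave, extended to $\mathbf{H}_+^n$ by $\phi(X)=\phi(\lambda(X))$. Then for any $H\in\mathbf{H}^n$ and any $\{p_j\}_{j=1}^m\subset(0,1]$ such that $\sum_{j=1}^m p_j\le 1$, the function $$(A_1,A_2,\dots,A_m)\ \longmapsto\ \phi\Big(\exp\Big(H+\sum_{j=1}^m p_j\log A_j\Big)\Big)$$ is jointly concave on $(\mathbf{H}_{++}^n)^{\times m}$. In particular, $A\mapsto\phi\big(\exp(H+\log A)\big)$ is concave on $\mathbf{H}_{++}^n$.
   Context: $\mathbb{R}_+=[0,\infty)$. $\mathbf{H}^n$, $\mathbf{H}_+^n$, $\mathbf{H}_{++}^n$ denote the $n\times n$ Hermitian, Hermitian positive semidefinite, and Hermitian positive definite matrices, respectively. For $X\in\mathbf{H}^n$, $\lambda(X)=(\lambda_1(X),\dots,\lambda_n(X))$ is the vector of eigenvalues in decreasing order, and scalar functions ($\exp$, $\log$) are applied to Hermitian matrices by spectral calculus. For vectors, products $xy$, powers $x^p$ and the order relations $x\ge y$, $x>y$ are entrywise. A continuous function $\phi:\mathbb{R}_+^n\to\mathbb{R}_+$ is a symmetric form if: (homogeneity) $\phi(tx)=t\phi(x)$ for all $x\in\mathbb{R}_+^n$, $t\in\mathbb{R}_+$; (monotonicity) for $x,y\in\mathbb{R}_+^n$, $\phi(x)\ge\phi(y)$ if $x\ge y$, and $\phi(x)>\phi(y)$ if $x>y$; (symmetry) $\phi(Px)=\phi(x)$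 for every permutation $P$ of the coordinates. A symmetric form $\phi$ is Hölder if $\phi(xy)\le\phi(x^p)^{1/p}\phi(y^q)^{1/q}$ for all $x,y\in\mathbb{R}_+^n$ and all $p,q\in[1,+\infty]$ with $\frac1p+\frac1q=1$, where $\phi(x^p)^{1/p}$ for $p=+\infty$ is read as the limit as $p\to+\infty$ (equivalently, the inequality is required for $p,q\in(1,\infty)$). It is concave if $\phi(\tau x+(1-\tau)y)\ge\tau\phi(x)+(1-\tau)\phi(y)$ for all $x,y\in\mathbb{R}_+^n$, $\tau\in[0,1]$. The extension of $\phi$ to $\mathbf{H}_+^n$ is $\phi(X)=\phi(\lambda(X))$. *)

(* Defs.v *)
From HB Require Import structures.
From mathcomp Require Import all_boot all_order all_algebra all_fingroup.
From mathcomp Require Import all_classical all_reals all_analysis.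
From mathcomp.real_closed Require Import complex.

Set Implicit Arguments.
Unset Strict Implicit.
Unset Printing Implicit Defensive.
Import Order.TTheory GRing.Theory Num.Theory numFieldNormedType.Exports.

Local Open Scope classical_set_scope.
Local Open Scope complex_scope.
Local Open Scope sesquilinear_scope.
Local Open Scope ring_scope.

Section SymmetricForms.
Variables (R : realType) (n : nat).
Implicit Types (x y : 'rV[R]_n) (phi : 'rV[R]_n -> R).

Definition nneg_orthant : set 'rV[R]_n := [set x | forall i, 0 <= x 0 i].

Definition vmul x y : 'rV[R]_n := map2_mx *%R x y.

Definition vpow x (p : R) : 'rV[R]_n := map_mx (fun a => a `^ p) x.

(* A form on the nonnegative orthant is encoded as a total function whose
   values outside the orthant are irrelevant. *)
Record is_symmetric_form phi : Prop := SymmetricForm {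
  form_ge0 : forall x, nneg_orthant x -> 0 <= phi x;
  form_continuous : {within nneg_orthant, continuous phi};
  form_homogeneous : forall (t : R) x, 0 <= t -> nneg_orthant x ->
    phi (t *: x) = t * phi x;
  form_le : forall x y, nneg_orthant x -> nneg_orthant y ->
    (forall i, y 0 i <= x 0 i) -> phi y <= phi x;
  form_lt : forall x y, nneg_orthant x -> nneg_orthant y ->
    (forall i, y 0 i < x 0 i) -> phi y < phi x;
  form_perm : forall (s : 'S_n) x, nneg_orthant x -> phi (col_perm s x) = phi x
}.

(* phi(x^p)^(1/p) for p in [1, +oo]. If the finite-exponent inequalities of
   [hoelder_form] hold, then (phi(x^r) / phi(1))^(1/r) is nondecreasing in r
   and bounded by the largest entry of x, so that the limit does exist. *)
Definition form_root phi x (p : \bar R) : R :=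
  match p with
  | r%:E => phi (vpow x r) `^ r^-1
  | +oo%E => lim (phi (vpow x r) `^ r^-1 @[r --> +oo])
  | -oo%E => 0
  end.

(* The inverse in extended reals satisfies (+oo)^-1 = 0. *)
Definition hoelder_form phi : Prop :=
  forall x y (p q : \bar R), nneg_orthant x -> nneg_orthant y ->
    (1 <= p)%E -> (1 <= q)%E -> (p^-1 + q^-1 = 1)%E ->
    phi (vmul x y) <= form_root phi x p * form_root phi y q.

Definition concave_form phi : Prop :=
  forall x y (t : R), nneg_orthant x -> nneg_orthant y -> 0 <= t <= 1 ->
    t * phi x + (1 - t) * phi y <= phi (t *: x + (1 - t) *: y).

End SymmetricForms.

Section HermitianMatrices.
Variables (R : realType) (n : nat).
Implicit Types (A X : 'M[R[i]]_n).

(* A positive element of [R[i]] is in particular real. *)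
Definition posdefmx A : Prop :=
  A \is hermsymmx /\
  forall v : 'rV[R[i]]_n, v != 0 -> 0 < (v *m A *m v^t*) 0 0.

(* Meaningful for Hermitian X, whose [spectral_diag] lists the (real)
   eigenvalues with multiplicity, in an unspecified order. *)
Definition eigvals X : 'rV[R]_n :=
  \row_(i < n) nth 0 (sort >=%R [seq complex.Re (spectral_diag X 0 j) | j <- enum 'I_n]) i.

(* f(X) = U^* diag(f(d_1), ..., f(d_n)) U for a unitary U such that
   X = U^* diag(d_1, ..., d_n) U. For Hermitian X, this does not depend on the
   diagonalization chosen by [spectralmx] and [spectral_diag]. *)
Definition spectral_fun (f : R -> R) X : 'M[R[i]]_n :=
  (spectralmx X)^t* *m
    diag_mx (map_mx (fun z => (f (complex.Re z))%:C) (spectral_diag X)) *m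
  spectralmx X.

Definition mxexp X := spectral_fun (@expR R) X.
Definition mxlog X := spectral_fun (@ln R) X.

Definition form_mx (phi : 'rV[R]_n -> R) X : R := phi (eigvals X).

End HermitianMatrices.

(* Only real weights occur; they are embedded into [R[i]] because the Hermitian
   matrices live in a module over [R[i]]. *)
Definition concave_on (R : realType) (V : lmodType R[i]) (D : set V)
    (f : V -> R) : Prop :=
  forall (A B : V) (t : R), D A -> D B -> 0 <= t <= 1 ->
    t * f A + (1 - t) * f B <= f (t%:C *: A + (1 - t)%:C *: B).

(* Main.v *)
(* Write F(u) = phi(e^u). By Hoelder and AM-GM, F is convex on R^n; together with
   the concavity of phi this makes phi differentiable at every a > 0, with a
   gradient w such that phi(c) <= <w, c> and
   phi(c) >= phi(a) + sum_i w_i a_i ln (c_i / a_i).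
   Let Y_k = H + sum_j p_j log A_kj = U_k^* diag(y_k) U_k for k = 1, 2, let w_k be
   the gradient of phi at e^(y_k), m_k = w_k e^(y_k), M_k = U_k^* diag(m_k) U_k and
   M = t M_1 + (1 - t) M_2 = U^* diag(mu) U. If y' is the diagonal of U Y U^*, then
   phi(e^Y) >= phi(e^y') by convexity of F and symmetry. The concavity of phi at
   e^y' = mu b, with b = e^y' / mu and mu a mixture of doubly stochastic images of
   m_1 and m_2, then bounds phi(e^Y) below by the average of the
   phi(e^(Y_k)) + tr M_k log M_k - tr M_k Y_k, plus tr M Y - tr M log M. Since the
   p_j sum to at most 1, the joint convexity of the relative entropy
   tr M (log M - log A) shows that the entropic terms add up to something
   nonnegative. *)
Require Import Defs.
From mathcomp Require Import all_boot all_order all_algebra all_fingroup.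
From mathcomp Require Import all_classical all_reals all_analysis.
From mathcomp Require Import ring lra.
From mathcomp.real_closed Require Import complex.

Set Implicit Arguments.
Unset Strict Implicit.
Unset Printing Implicit Defensive.
Import Order.TTheory GRing.Theory Num.Theory numFieldNormedType.Exports.

Local Open Scope classical_set_scope.
Local Open Scope complex_scope.
Local Open Scope sesquilinear_scope.
Local Open Scope ring_scope.

(** * A sign criterion for logarithmic sums *)

Section LogarithmicSums.
Variables (R : realType) (I : finType).
Implicit Types c x : I -> R.

(* [G s = \sum_i c i * ln (x i + s)] is nondecreasing and tends to 0 as
   [s --> +oo], because [\sum_i c i = 0]; hence [G 0 <= 0]. This replaces the
   integral representation of the logarithm. *)
Lemma sum_mul_ln_le0 c x : (forall i, 0 < x i) -> \sum_i c i = 0 ->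
  (forall s : R, 0 < s -> 0 <= \sum_i c i / (x i + s)) ->
  \sum_i c i * ln (x i) <= 0.
Proof.
move=> x_gt0 c0 cx_ge0; pose G (s : R) := \sum_i c i * ln (x i + s).
have xs_gt0 i (s : R) : 0 <= s -> 0 < x i + s by move=> s0; rewrite ltr_wpDr.
have dG (s : R) : 0 <= s -> is_derive s 1 G (\sum_i c i / (x i + s)).
  move=> s0.
  have -> : G = \sum_i (fun t => c i * ln (x i + t)).
    by apply/funext => t; rewrite fct_sumE.
  elim/big_rec2: _ => [|i df f _ IHf]; first exact: is_derive_cst.
  apply: is_deriveD; apply: is_deriveZ.
  have dln := is_derive1_ln (xs_gt0 i _ s0).
  have dx : is_derive s 1 (fun t => x i + t) (0 + 1) by apply: is_deriveD.
  by apply: is_derive_eq (is_derive1_comp dln dx) _; rewrite add0r mulr1.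
(* The hypothesis says exactly that the derivative of [G] is nonnegative on the open half-line. *)
have G_homo b : 0 < b -> G 0 <= G b.
  move=> b0; apply: (@ger0_derive1_le_cc _ G 0 b).
  - move=> s; rewrite in_itv /= => /andP[/ltW s0 _].
    exact: (@ex_derive _ _ _ _ _ _ _ (dG s s0)).
  - move=> s; rewrite in_itv /= => /andP[s0 _].
    have d := dG s (ltW s0).
    by rewrite derive1E derive_val cx_ge0.
  - apply: derivable_within_continuous => s; rewrite in_itv /= => /andP[s0 _].
    exact: (@ex_derive _ _ _ _ _ _ _ (dG s s0)).
  - by rewrite in_itv /= lexx ltW.
  - by rewrite in_itv /= lexx ltW.
  - exact: ltW.
(* As the [c i] sum to 0, [ln b] can be subtracted from every logarithm; then
   [ln (1 + x i / b) <= x i / b]. *)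
have G_le b : 0 < b -> G b <= (\sum_i `|c i| * x i) / b.
  move=> b0; have -> : G b = \sum_i c i * ln (1 + x i / b).
    have c_ln : \sum_i c i * ln b = 0 by rewrite -mulr_suml c0 mul0r.
    rewrite -[RHS]addr0 -{2}c_ln -big_split /=.
    apply: eq_bigr => i _; rewrite -mulrDr -lnM ?posrE ?addr_gt0 ?divr_gt0 //.
    by congr (_ * ln _); field; rewrite gt_eqF.
  rewrite mulr_suml; apply: ler_sum => i _; rewrite -mulrA.
  have xb : 0 < x i / b by rewrite divr_gt0.
  apply: (le_trans (ler_norm _)); rewrite normrM ler_wpM2l // ger0_norm.
    by rewrite le_ln1Dx // (lt_trans _ xb).
  by rewrite ln_ge0 // lerDl ltW.
have -> : \sum_i c i * ln (x i) = G 0 by apply: eq_bigr => i _; rewrite addr0.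
set K := \sum_i `|c i| * x i in G_le.
have K0 : 0 <= K by apply: sumr_ge0 => i _; rewrite mulr_ge0 // ltW.
apply/ler_addgt0Pr => e e0; rewrite add0r.
have Ke : 0 < (K + 1) / e by rewrite divr_gt0 // ltr_wpDl.
rewrite (le_trans (G_homo _ Ke)) // (le_trans (G_le _ Ke)) //.
rewrite invf_div mulrCA ger_pMr // ler_pdivrMr ?mul1r ?lerDl //.
by rewrite ltr_wpDl.
Qed.

End LogarithmicSums.

(** * Rearrangement for doubly stochastic matrices *)

Section Rearrangement.
Variable R : realType.

Definition doubly_stochastic n (D : 'M[R]_n) : Prop :=
  [/\ forall i j, 0 <= D i j, forall i, \sum_j D i j = 1
    & forall j, \sum_i D i j = 1].

(* [G i * X i - v i] and [v j] are dual potentials of the transport problem with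
   gain [G i * X j], certifying that the identity coupling is optimal. *)
Lemma sorted_potential n (X G : nat -> R) :
  (forall i j, (i <= j < n)%N -> X j <= X i) ->
  (forall i j, (i <= j < n)%N -> G j <= G i) ->
  exists v : nat -> R, forall i j, (i < n)%N -> (j < n)%N ->
    G i * (X j - X i) <= v j - v i.
Proof.
move=> Xs Gs; exists (fun j => \sum_(k < j) G k * (X k.+1 - X k)).
move=> i j; case: (leqP i j) => [le_ij _ | /ltnW le_ji].
  have [d ->] : exists d, j = (i + d)%N by exists (j - i)%N; rewrite subnKC.
  elim: d => [|d IHd] lt_n; first by rewrite addn0 !subrr mulr0.
  rewrite addnS in lt_n *.
  rewrite big_ord_recr /= addrAC.
  have -> : X (i + d).+1 - X i = (X (i + d)%N - X i) + (X (i + d).+1 - X (i + d)%N).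
    by ring.
  rewrite mulrDr lerD ?IHd ?(ltnW lt_n) //.
  by rewrite ler_wnM2r ?Gs ?subr_le0 ?Xs ?leq_addr ?(ltnW lt_n) ?leqnSn.
move=> lt_i _; have [d Ed] : exists d, i = (j + d)%N by exists (i - j)%N; rewrite subnKC.
rewrite Ed in lt_i *; clear le_ji Ed.
(* The induction on [d] moves the end index, hence the slope [G (j + d)]. Any slope [g] below it
   works, and such a [g] stays admissible for smaller [d]. *)
suff H : forall g, g <= G (j + d)%N -> g * (X j - X (j + d)%N) <=
  \sum_(k < j) G k * (X k.+1 - X k) - \sum_(k < j + d) G k * (X k.+1 - X k).
  exact: H.
elim: d lt_i => [|d IHd] lt_n g gle; first by rewrite addn0 !subrr mulr0.
rewrite addnS in lt_n gle *.
have leG : G (j + d).+1 <= G (j + d)%N by rewrite Gs // leqnSn.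
rewrite big_ord_recr /= opprD addrA.
have -> : X j - X (j + d).+1 = (X j - X (j + d)%N) + (X (j + d)%N - X (j + d).+1).
  by ring.
rewrite mulrDr lerD ?IHd ?(ltnW lt_n) ?(le_trans gle) //.
rewrite -mulrN opprB ler_wpM2r ?subr_ge0 ?Xs ?leqnSn //.
by rewrite (le_trans gle).
Qed.

Lemma sorting_perm n (x : 'rV[R]_n) :
  exists s : 'S_n, forall i j : 'I_n, (i <= j)%N -> x 0 (s j) <= x 0 (s i).
Proof.
pose t := [tuple x 0 i | i < n].
have : perm_eq (sort >=%R t) t by rewrite perm_sort.
move=> /tuple_permP[s E]; exists s => i j le_ij.
have srt : sorted >=%R (sort >=%R t).
  by apply: sort_sorted => a b; rewrite orbC; exact: le_total.
have sz : size (sort >=%R t) = n by rewrite size_sort size_tuple.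
have nthE (k : 'I_n) : nth 0 (sort >=%R t) k = x 0 (s k).
  by rewrite E -(tnth_nth 0) tnth_mktuple tnth_mktuple.
rewrite -!nthE; apply: (sorted_leq_nth _ _ _ srt) => //.
- by move=> a b c /= ab bc; exact: le_trans bc ab.
- by move=> a /=; exact: lexx.
- by rewrite inE sz.
- by rewrite inE sz.
Qed.

(** Weak duality takes the place of Birkhoff's theorem. After sorting [g] and [x], the potentials
    satisfy [g i * x j <= ui i + vi j], with equality along the permutation that matches the two
    orders. Averaging this bound against [D] gives the sum of all potentials, because rows and
    columns of [D] sum to 1. *)
Lemma doubly_stochastic_rearrangement n (D : 'M[R]_n) (g x : 'rV[R]_n) :
  doubly_stochastic D ->
  exists s : 'S_n,
    \sum_i \sum_j g 0 i * D i j * x 0 j <= \sum_i g 0 i * x 0 (s i).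
Proof.
case: n D g x => [|n] D g x [D_ge0 Drow Dcol].
  by exists 1%g; rewrite !big_ord0.
have [s xs] := sorting_perm x; have [r gr] := sorting_perm g.
pose X k := x 0 (s (inord k)); pose G k := g 0 (r (inord k)).
have [v vP] : exists v : nat -> R, forall i j, (i < n.+1)%N -> (j < n.+1)%N ->
    G i * (X j - X i) <= v j - v i.
  apply: sorted_potential => i j /andP[le_ij lt_j].
    by apply: xs; rewrite !inordK // (leq_ltn_trans le_ij).
  by apply: gr; rewrite !inordK // (leq_ltn_trans le_ij).
exists (r^-1 * s)%g.
pose vi (i : 'I_n.+1) := v (s^-1 i)%g.
pose ui (i : 'I_n.+1) := g 0 i * x 0 (s (r^-1 i))%g - v (r^-1 i)%g.
have uv i j : g 0 i * x 0 j <= ui i + vi j.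
  have := vP (r^-1 i)%g (s^-1 j)%g (ltn_ord _) (ltn_ord _).
  rewrite /X /G !inord_val !permKV /ui /vi mulrBr; lra.
have -> : \sum_i g 0 i * x 0 ((r^-1 * s)%g i) = \sum_i ui i + \sum_i vi i.
  have -> : \sum_i vi i = \sum_i v (r^-1 i)%g.
    rewrite (reindex_inj (@perm_inj _ s)) /= [RHS](reindex_inj (@perm_inj _ r)) /=.
    by apply: eq_bigr => i _; rewrite /vi !permK.
  by rewrite -big_split; apply: eq_bigr => i _; rewrite /ui permM /= subrK.
apply: (@le_trans _ _ (\sum_i \sum_j D i j * (ui i + vi j))).
  apply: ler_sum => i _; apply: ler_sum => j _.
  by rewrite -mulrA mulrCA ler_wpM2l.
under eq_bigr do under eq_bigr do rewrite mulrDr.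
under eq_bigr do rewrite big_split /=.
rewrite big_split /= lerD //.
  by under eq_bigr do rewrite -mulr_suml Drow mul1r.
rewrite exchange_big /=.
by under eq_bigr do rewrite -mulr_suml Dcol mul1r.
Qed.

End Rearrangement.

(** * Gradients of Hoelder concave forms *)

Section Gradient.
Variables (R : realType) (n : nat).
Implicit Types (u v x y a c w m : 'rV[R]_n) (t s k e : R).

(* The one-sided directional derivative [p] of a convex function is sublinear;
   the second hypothesis makes it odd, hence linear. *)
Lemma convex_gradient (F : 'rV[R]_n -> R) y :
  (forall u v t, 0 <= t <= 1 ->
     F (t *: u + (1 - t) *: v) <= t * F u + (1 - t) * F v) ->
  (forall v e, 0 < e -> exists2 t, 0 < t &
     F (y + t *: v) + F (y - t *: v) - 2 * F y <= e * t) ->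
  exists m, (forall v, F y + \sum_i m 0 i * v 0 i <= F (y + v)) /\
    (forall v k, (forall s, 0 < s <= 1 -> F y + s * k <= F (y + s *: v)) ->
       k <= \sum_i m 0 i * v 0 i).
Proof.
move=> Fconv Fsmooth; pose q t v := (F (y + t *: v) - F y) / t.
(* Difference quotients of a convex function are nondecreasing in the step. *)
have q_homo v s t : 0 < s -> s <= t -> q s v <= q t v.
  move=> s0 st; have t0 := lt_le_trans s0 st.
  rewrite /q ler_pdivrMr // mulrAC -mulrA.
  have st1 : 0 <= s / t <= 1 by rewrite divr_ge0 ?(ltW s0) ?(ltW t0) //= ler_pdivrMr ?mul1r.
  have -> : y + s *: v = (s / t) *: (y + t *: v) + (1 - s / t) *: y.
    rewrite scalerDr scalerBl scale1r scalerA divfK ?gt_eqF //.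
    by rewrite addrAC [_ + (y - _)]addrC subrK.
  have := Fconv (y + t *: v) y _ st1; lra.
(* Convexity at [y], which lies between [y - s *: v] and [y + t *: v]. This bounds the quotients
   from below, so the infimum [p] is finite. *)
have qN v s t : 0 < s -> 0 < t -> - q s (- v) <= q t v.
  move=> s0 t0; have st0 : 0 < s + t by rewrite addr_gt0.
  have sst : 0 <= s / (s + t) <= 1.
    by rewrite divr_ge0 ?(ltW s0) ?(ltW st0) //= ler_pdivrMr ?mul1r // lerDl ltW.
  have := Fconv (y + t *: v) (y + s *: - v) _ sst.
  have -> : (s / (s + t)) *: (y + t *: v) + (1 - s / (s + t)) *: (y + s *: - v) = y.
    apply/rowP => i; rewrite !mxE; field; exact: lt0r_neq0.
  rewrite /q => H; rewrite -mulNr opprB ler_pdivlMr // mulrAC ler_pdivrMr //.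
  move: H; rewrite -(ler_pM2r st0) => H.
  suff E : (s / (s + t) * F (y + t *: v) + (1 - s / (s + t)) * F (y + s *: - v)) * (s + t)
    = s * F (y + t *: v) + t * F (y + s *: - v) by move: H; rewrite E; lra.
  by field; exact: lt0r_neq0.
pose p v := inf [set q t v | t in [set t | 0 < t]].
have Qn0 v : [set q t v | t in [set t | 0 < t]] !=set0 by exists (q 1 v), 1; rewrite /= ?ltr01.
have p_le v t : 0 < t -> p v <= q t v.
  move=> t0; apply: ge_inf; last by exists t.
  by exists (- q 1 (- v)) => _ [s s0 <-]; rewrite qN.
have le_p v k : (forall t, 0 < t -> k <= q t v) -> k <= p v.
  by move=> kq; apply: lb_le_inf => // _ [t t0 <-]; exact: kq.
have pD u v : p (u + v) <= p u + p v.
  rewrite -lerBlDr; apply: (le_p) => t1 t1_gt0; rewrite lerBlDr -lerBlDl.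
  apply: (le_p) => t2 t2_gt0; rewrite lerBlDl.
  (* With this step [y + t *: (u + v)] is the midpoint of [y + (t * 2) *: u] and [y + (t * 2) *: v],
     and [t * 2] exceeds neither [t1] nor [t2]. *)
  pose t := Num.min t1 t2 / 2.
  have t0 : 0 < t by rewrite divr_gt0 // lt_min t1_gt0.
  have t20 : 0 < t * 2 by rewrite mulr_gt0.
  apply: (@le_trans _ _ (q (t * 2) u + q (t * 2) v)); last first.
    by rewrite lerD // q_homo // /t divfK ?pnatr_eq0 // ge_min lexx ?orbT.
  apply: (le_trans (p_le _ _ t0)); rewrite /q -mulrDl ler_pdivlMr // mulrA divfK ?gt_eqF //.
  have h : 0 <= (2^-1 : R) <= 1 by lra.
  have := Fconv (y + (t * 2) *: u) (y + (t * 2) *: v) _ h.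
  have -> : 2^-1 *: (y + (t * 2) *: u) + (1 - 2^-1) *: (y + (t * 2) *: v) = y + t *: (u + v).
    by apply/rowP => i; rewrite !mxE; field.
  lra.
have p0 : p 0 = 0.
  apply/le_anti/andP; split.
    by rewrite (le_trans (p_le _ _ ltr01)) // /q scaler0 addr0 subrr mul0r.
  by apply: (le_p) => t t0; rewrite /q scaler0 addr0 subrr mul0r.
(* Subadditivity gives one inequality; the bound on second differences gives [p v + p (- v) <= e]
   for every [e > 0]. *)
have pN v : p (- v) = - p v.
  apply/eqP; rewrite eq_le; apply/andP; split; last first.
    by rewrite -subr_ge0 opprK addrC; have := pD v (- v); rewrite subrr p0.
  rewrite lerNr -subr_le0 opprK; apply/ler_addgt0Pr => e e0; rewrite add0r.
  have [t t0 Ht] := Fsmooth v e e0.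
  rewrite (le_trans (lerD (p_le _ _ t0) (p_le _ _ t0))) // /q -mulrDl ler_pdivrMr // scalerN.
  by move: Ht; lra.
have pZ k v : p (k *: v) = k * p v.
  have pZ_gt0 : forall k v, 0 < k -> p (k *: v) = k * p v.
    move=> {}k {}v k0.
    have le1 l x : 0 < l -> l * p x <= p (l *: x).
      move=> l0; apply: (le_p) => t t0.
      have -> : q t (l *: x) = l * q (t * l) x.
        by rewrite /q scalerA; field; rewrite !gt_eqF.
      by rewrite ler_wpM2l ?(ltW l0) // p_le // mulr_gt0.
    apply/eqP; rewrite eq_le le1 // andbT.
    rewrite -ler_pdivrMl // -[in X in _ <= X](scalerK (lt0r_neq0 k0) v).
    by apply: (le1); rewrite invr_gt0.
  case: (ltgtP k 0) => [k0 | /pZ_gt0-> // | ->]; last by rewrite scale0r mul0r.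
  by rewrite -[k]opprK scaleNr pN pZ_gt0 ?oppr_gt0 // !mulNr.
have p_sum v : p v = \sum_i p (delta_mx 0 i) * v 0 i.
  have p_add u x : p (u + x) = p u + p x.
    apply/eqP; rewrite eq_le pD /= -lerBrDr -pN.
    by have := pD (u + x) (- x); rewrite addrK.
  rewrite {1}(row_sum_delta v) (big_morph p p_add p0).
  by apply: eq_bigr => i _; rewrite pZ mulrC.
exists (\row_i p (delta_mx 0 i)); split=> [v | v k Hk].
  have := p_le v 1 ltr01; rewrite /q scale1r divr1 p_sum.
  by under [in X in _ -> X]eq_bigr do rewrite mxE; lra.
under eq_bigr do rewrite mxE; rewrite -p_sum; apply: (le_p) => t t0.
(* The hypothesis on [k] covers steps up to 1 only; monotonicity of the quotients carries it to
   larger [t]. *)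
pose s := Num.min t 1.
have s0 : 0 < s by rewrite lt_min t0 ltr01.
rewrite (le_trans _ (q_homo v s t s0 _)) ?ge_min ?lexx //.
rewrite /q ler_pdivlMr //; have := Hk s; rewrite s0 ge_min lexx orbT => /(_ isT); lra.
Qed.

End Gradient.

(** * Log-tangents of Hölder concave forms *)

Section LogTangent.
Variables (R : realType) (n : nat).
Implicit Types (u v x y a b c w m : 'rV[R]_n) (t s k e : R).

(* [w] is at once a supergradient of [phi] at [a] and, in the coordinates
   [ln x], a subgradient; the first equation is Euler's identity. *)
Definition log_tangent (phi : 'rV[R]_n -> R) a w : Prop :=
  [/\ phi a = \sum_i w 0 i * a 0 i,
      forall c, nneg_orthant c -> phi c <= \sum_i w 0 i * c 0 i
    & forall c, (forall i, 0 < c 0 i) ->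
        phi a + \sum_i w 0 i * a 0 i * (ln (c 0 i) - ln (a 0 i)) <= phi c].

(** Hölder with the exponents [t^-1] and [(1 - t)^-1], applied to [e^(t u)] and [e^((1 - t) v)],
    bounds the left side by [phi(e^u)^t * phi(e^v)^(1 - t)]; Young's inequality concludes. The
    endpoints are treated apart because one exponent would be infinite there. *)
Lemma hoelder_form_exp_convex (phi : 'rV[R]_n -> R) u v t :
  is_symmetric_form phi -> hoelder_form phi -> 0 <= t <= 1 ->
  phi (map_mx (@expR R) (t *: u + (1 - t) *: v)) <=
    t * phi (map_mx (@expR R) u) + (1 - t) * phi (map_mx (@expR R) v).
Proof.
move=> phi_form phi_hoelder /andP[t0 t1].
have exp_ge0 x : nneg_orthant (map_mx (@expR R) x) by move=> i; rewrite mxE expR_ge0.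
case: (eqVneq t 0) => [-> | t_neq0].
  by rewrite scale0r add0r subr0 scale1r mul0r add0r mul1r.
case: (eqVneq t 1) => [-> | t_neq1].
  by rewrite scale1r subrr scale0r addr0 mul0r addr0 mul1r.
have {}t0 : 0 < t by rewrite lt_def t_neq0.
have {}t1 : 0 < 1 - t by rewrite subr_gt0 lt_neqAle t_neq1.
have vpow_exp s x : 0 < s ->
    vpow (map_mx (@expR R) (s *: x)) s^-1 = map_mx (@expR R) x.
  move=> s0; apply/rowP => i; rewrite !mxE /powR gt_eqF ?expR_gt0 // expRK.
  by rewrite mulKf // gt_eqF.
have -> : map_mx (@expR R) (t *: u + (1 - t) *: v) =
    vmul (map_mx (@expR R) (t *: u)) (map_mx (@expR R) ((1 - t) *: v)).
  by apply/rowP => i; rewrite !mxE expRD.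
have inv1 s : 0 < s -> s <= 1 -> (1 <= (s^-1)%:E)%E.
  by move=> s0 s1; rewrite lee_fin invf_ge1.
apply: (le_trans (phi_hoelder _ _ (t^-1)%:E (1 - t)^-1%:E _ _ _ _ _)) => //.
- by apply: inv1 => //; lra.
- by apply: inv1 => //; lra.
- by rewrite !inver !invr_eq0 !gt_eqF // !invrK -EFinD; congr (_%:E); ring.
rewrite /= !vpow_exp // !invrK.
have phi_ge0 x : 0 <= phi (map_mx (@expR R) x) by apply: (form_ge0 phi_form).
have := @conjugate_powR R (phi (map_mx (@expR R) u) `^ t)
  (phi (map_mx (@expR R) v) `^ (1 - t)) t^-1 (1 - t)^-1.
rewrite -!powRrM !divff ?gt_eqF // !powRr1 // !invrK => H.
rewrite [t * phi _]mulrC [(1 - t) * phi _]mulrC.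
apply: H; rewrite ?powR_ge0 ?invr_gt0 //; ring.
Qed.

(** Concavity bounds the two values by twice the value at the midpoint, whose entries are
    [e^(y_i) cosh(t v_i)]. These are at most [(1 + O(t^2)) e^(y_i)], so by monotonicity and
    homogeneity the second difference is [O(t^2)]. *)
Lemma concave_form_exp_smooth (phi : 'rV[R]_n -> R) y v e :
  is_symmetric_form phi -> concave_form phi -> 0 < e ->
  exists2 t, 0 < t &
    phi (map_mx (@expR R) (y + t *: v)) + phi (map_mx (@expR R) (y - t *: v))
      - 2 * phi (map_mx (@expR R) y) <= e * t.
Proof.
move=> phi_form phi_concave e0.
set a := map_mx _ y.
have exp_ge0 x : nneg_orthant (map_mx (@expR R) x) by move=> i; rewrite mxE expR_ge0.
have phia0 : 0 <= phi a by apply: (form_ge0 phi_form); exact: exp_ge0.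
pose V := 1 + \sum_i `|v 0 i|; pose C := V ^+ 2 * expR V.
have V_ge i : `|v 0 i| <= V.
  by rewrite /V (bigD1 i) //= addrCA lerDl addr_ge0 // sumr_ge0.
have V0 : 0 < V by rewrite ltr_wpDr // sumr_ge0.
have C0 : 0 < C by rewrite mulr_gt0 ?exprn_gt0 ?expR_gt0.
(* [t <= 1] keeps [|t v_i| <= V], so that [C] controls the error in [cosh]; the second bound makes
   [t^2 C phi(a) <= e t]. The added 1 keeps the denominator positive. *)
pose t := Num.min 1 (e / (C * (phi a + 1))).
have Cp : 0 < C * (phi a + 1) by rewrite mulr_gt0 // ltr_wpDl.
have t0 : 0 < t by rewrite lt_min ltr01 divr_gt0.
have t1 : t <= 1 by rewrite ge_min lexx.
exists t => //.
(* From [e^z + e^(-z) - 2 = e^z (1 - e^(-z))^2] and [1 - e^(-z) <= z]. *)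
have cosh_ge0 (z : R) : 0 <= z -> expR z + expR (- z) <= 2 + z ^+ 2 * expR z.
  move=> z0; have e1 : 1 - expR (- z) <= z by have := expR_ge1Dx (- z); lra.
  have ez := expR_gt0 z; have E : expR z * expR (- z) = 1 by rewrite expRN divff ?gt_eqF.
  have : (expR z * (1 - expR (- z))) * (1 - expR (- z)) <= (expR z * z) * z.
    by rewrite ler_pM ?mulr_ge0 ?ler_pM2l ?(ltW ez) // subr_ge0 -expR0 ler_expR oppr_le0.
  have -> : expR z * (1 - expR (- z)) * (1 - expR (- z)) =
      expR z - 2 * (expR z * expR (- z)) + expR z * expR (- z) * expR (- z) by ring.
  by rewrite E; lra.
have cosh_le (z : R) : expR z + expR (- z) <= 2 + z ^+ 2 * expR `|z|.
  case: (leP 0 z) => [z0 | /ltW z0]; first by rewrite ger0_norm // cosh_ge0.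
  have := cosh_ge0 (- z); rewrite opprK sqrrN oppr_ge0 => /(_ z0).
  by rewrite ler0_norm // addrC.
have half : 0 <= (2^-1 : R) <= 1 by lra.
have := phi_concave _ _ _ (exp_ge0 (y + t *: v)) (exp_ge0 (y - t *: v)) half.
set b := _ + _ *: map_mx _ _ => Hb.
have Hle : phi b <= phi ((1 + 2^-1 * (t ^+ 2 * C)) *: a).
  apply: (form_le phi_form).
  - move=> i; rewrite !mxE mulr_ge0 ?expR_ge0 // addr_ge0 //.
    by rewrite !mulr_ge0 ?invr_ge0 ?sqr_ge0 // ltW.
  - by move=> i; rewrite /b !mxE addr_ge0 // mulr_ge0 ?expR_ge0 //; lra.
  move=> i; rewrite /b !mxE !expRD.
  have ey := expR_gt0 (y 0 i).
  suff : expR (t * v 0 i) + expR (- (t * v 0 i)) <= 2 + t ^+ 2 * C.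
    rewrite -(ler_pM2l ey) !mulrDr; lra.
  rewrite (le_trans (cosh_le _)) // lerD2l exprMn -mulrA ler_wpM2l ?sqr_ge0 // /C.
  rewrite ler_pM ?expR_ge0 ?sqr_ge0 //.
    by rewrite -(real_normK (num_real (v 0 i))) lerXn2r ?nnegrE // ltW.
  by rewrite ler_expR normrM (gtr0_norm t0) (le_trans _ (V_ge i)) // ler_piMl.
have {Hle} : phi b <= (1 + 2^-1 * (t ^+ 2 * C)) * phi a.
  rewrite -(form_homogeneous phi_form) //; last exact: exp_ge0.
  by rewrite addr_ge0 // !mulr_ge0 ?invr_ge0 ?sqr_ge0 // ltW.
have : t * (C * (phi a + 1)) <= e by rewrite -ler_pdivlMr // ge_min lexx orbT.
rewrite -(ler_pM2l t0) => Ht.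
have : 0 <= t * (t * C) by rewrite !mulr_ge0 // ltW.
rewrite expr2; move: Ht Hb; rewrite -/a; nra.
Qed.

(** Let [m] be the gradient of [phi(e^u)] at [u = ln a], and [w = m / a]. The lower bound is the
    subgradient inequality for [m]; the upper bound comes from concavity of [phi] along the segment
    from [a] to [c]; monotonicity makes [w] nonnegative. *)
Lemma form_log_tangent (phi : 'rV[R]_n -> R) a :
  is_symmetric_form phi -> hoelder_form phi -> concave_form phi ->
  (forall i, 0 < a 0 i) ->
  exists2 w : 'rV[R]_n, (forall i, 0 <= w 0 i) & log_tangent phi a w.
Proof.
move=> phi_form phi_hoelder phi_concave a0.
pose y := map_mx (@ln R) a.
have exp_ln c : (forall i, 0 < c 0 i) -> map_mx (@expR R) (map_mx (@ln R) c) = c.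
  by move=> c0; apply/rowP => i; rewrite !mxE lnK // posrE.
have exp_ge0 x : nneg_orthant (map_mx (@expR R) x) by move=> i; rewrite mxE expR_ge0.
have a_ge0 : nneg_orthant a by move=> i; exact: ltW.
have [m [m_sub m_sup]] := @convex_gradient R n (fun u => phi (map_mx (@expR R) u)) y
  (fun u v t => hoelder_form_exp_convex u v phi_form phi_hoelder)
  (fun v e => concave_form_exp_smooth y v phi_form phi_concave).
pose w := \row_i (m 0 i / a 0 i).
have wa i : w 0 i * a 0 i = m 0 i by rewrite mxE divfK ?gt_eqF.
have sup c : nneg_orthant c -> phi c <= phi a + \sum_i w 0 i * (c 0 i - a 0 i).
  move=> c0; rewrite -lerBlDl.
  (* The segment point [a + s (c - a)] equals [a (1 + s v)], which lies below [a e^(s v)]; so the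
     exponential curve in direction [v] grows at least as fast as the chord. *)
  pose v := \row_i ((c 0 i - a 0 i) / a 0 i).
  have -> : \sum_i w 0 i * (c 0 i - a 0 i) = \sum_i m 0 i * v 0 i.
    by apply: eq_bigr => i _; rewrite !mxE mulrAC mulrA.
  apply: m_sup => s /andP[s0 s1]; rewrite exp_ln //.
  have s01 : 0 <= s <= 1 by rewrite s1 ltW.
  apply: (@le_trans _ _ (s * phi c + (1 - s) * phi a)); first lra.
  rewrite (le_trans (phi_concave _ _ _ c0 a_ge0 s01)) //.
  apply: (form_le phi_form) => // i.
    by rewrite !mxE addr_ge0 // mulr_ge0 ?c0 ?a_ge0 ?subr_ge0 // ltW.
  rewrite !mxE expRD lnK ?posrE //.
  have -> : s * c 0 i + (1 - s) * a 0 i = a 0 i * (1 + s * ((c 0 i - a 0 i) / a 0 i)).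
    by field; rewrite gt_eqF.
  by rewrite ler_pM2l // expR_ge1Dx.
exists w => [i|].
  have c0 : nneg_orthant (a + delta_mx 0 i).
    by move=> j; rewrite !mxE addr_ge0 ?a_ge0 ?ler0n.
  have := sup _ c0; rewrite (bigD1 i) //= big1 ?addr0 => [|j ji]; last first.
    by rewrite !mxE eqxx (negbTE ji) addr0 subrr mulr0.
  rewrite [X in _ * (X - _)]mxE addrAC subrr add0r [X in _ * X]mxE !eqxx mulr1 => H.
  have := form_le phi_form c0 a_ge0 => /(_ _)/le_trans/(_ H).
  rewrite lerDl; apply => j; rewrite !mxE lerDl ler0n //.
(* The two inequalities are [sup] tested at [2 *: a] and at [0 *: a]. *)
have euler : phi a = \sum_i w 0 i * a 0 i.
  apply/eqP; rewrite eq_le; apply/andP; split.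
    have c0 : nneg_orthant (2 *: a) by move=> i; rewrite mxE mulr_ge0 ?a_ge0.
    have := sup _ c0; rewrite (form_homogeneous phi_form) //.
    have -> : \sum_i w 0 i * ((2 *: a) 0 i - a 0 i) = \sum_i w 0 i * a 0 i.
      by apply: eq_bigr => i _; rewrite [X in _ * (X - _)]mxE; congr (_ * _); ring.
    lra.
  have c0 : nneg_orthant (0 *: a) by move=> i; rewrite mxE mul0r.
  have := sup _ c0; rewrite (form_homogeneous phi_form) //.
  have -> : \sum_i w 0 i * ((0 *: a) 0 i - a 0 i) = - \sum_i w 0 i * a 0 i.
    rewrite -sumrN; apply: eq_bigr => i _; rewrite [X in _ * (X - _)]mxE.
    by rewrite mul0r sub0r mulrN.
  lra.
split=> //.
- move=> c c0; rewrite (le_trans (sup _ c0)) // euler -big_split /=.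
  by rewrite le_eqVlt; apply/orP; left; apply/eqP/eq_bigr => i _; ring.
- move=> c c0; have := m_sub (map_mx (@ln R) c - y).
  rewrite [y + _]addrC subrK !exp_ln //; apply: le_trans; rewrite lerD2l.
  by rewrite le_eqVlt; apply/orP; left; apply/eqP/eq_bigr => i _; rewrite wa !mxE.
Qed.

End LogTangent.

(** * Spectral representations of Hermitian matrices *)

Lemma mxtrace_mul6 (K : comNzRingType) n (A B C D E F : 'M[K]_n) :
  \tr (A *m B *m C *m (D *m E *m F)) = \tr (B *m (C *m D) *m E *m (F *m A)).
Proof. by rewrite -!mulmxA mxtrace_mulC !mulmxA. Qed.

Section SpectralForm.
Variables (R : realType) (n : nat).
Notation C := R[i].
Implicit Types (X Y Z U V W : 'M[C]_n) (d m a : 'rV[R]_n).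

Definition sqmod (z : C) : R := complex.Re z ^+ 2 + complex.Im z ^+ 2.

(** The trace of a product of two Hermitian matrices is real; taking the real part places it in [R],
    where inequalities are stated. *)
Definition retr X : R := complex.Re (\tr X).

Definition rdiag d : 'M[C]_n := diag_mx (map_mx (real_complex R) d).

Definition unitary_diag U d : 'M[C]_n := U^t* *m rdiag d *m U.

Lemma sqmod_ge0 z : 0 <= sqmod z.
Proof. by rewrite addr_ge0 ?sqr_ge0. Qed.

Lemma conjC_real (x : R) : Num.conj (x%:C : C) = x%:C.
Proof. exact: conjc_real. Qed.

Lemma mul_conjC_sqmod (z : C) : z * Num.conj z = (sqmod z)%:C.
Proof. by rewrite /sqmod; case: z => x y; simpc; congr (_ +i* _) => /=; ring. Qed.

Lemma sqmod_conjC (z : C) : sqmod (Num.conj z) = sqmod z.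
Proof. by case: z => x y; rewrite /sqmod /= sqrrN. Qed.

Lemma ReD (x y : C) : complex.Re (x + y) = complex.Re x + complex.Re y.
Proof. by case: x y => [? ?] [? ?]. Qed.

Lemma Re_sum (I : Type) (r : seq I) (P : pred I) (F : I -> C) :
  complex.Re (\sum_(i <- r | P i) F i) = \sum_(i <- r | P i) complex.Re (F i).
Proof. by rewrite (big_morph _ ReD (erefl _)). Qed.

Lemma ReZ (x : R) (z : C) : complex.Re (x%:C * z) = x * complex.Re z.
Proof. by case: z => a b; simpc. Qed.

Lemma retr_lin (I : finType) (t : I -> R) (X : I -> 'M[C]_n) :
  retr (\sum_i (t i)%:C *: X i) = \sum_i t i * retr (X i).
Proof.
rewrite /retr [\tr _]raddf_sum Re_sum; apply: eq_bigr => i _ /=.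
by rewrite mxtraceZ ReZ.
Qed.

Lemma retrD X Y : retr (X + Y) = retr X + retr Y.
Proof. by rewrite /retr mxtraceD ReD. Qed.

Lemma trmxC_mul (p q r : nat) (A : 'M[C]_(p, q)) (B : 'M[C]_(q, r)) :
  (A *m B)^t* = B^t* *m A^t*.
Proof. by rewrite trmx_mul map_mxM. Qed.

Lemma rdiag_adj d : (rdiag d)^t* = rdiag d.
Proof.
rewrite /rdiag tr_diag_mx map_diag_mx -map_mx_comp; congr diag_mx.
by apply/rowP => i; rewrite !mxE /= conjC_real.
Qed.

Lemma unitary_mulmxtV U : U \is unitarymx -> U *m U^t* = 1%:M.
Proof. by move/unitarymxP. Qed.

Lemma unitary_mulmxVt U : U \is unitarymx -> U^t* *m U = 1%:M.
Proof. by move=> Uu; rewrite -invmx_unitary // mulVmx // unitarymx_unit. Qed.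

Lemma hermsymmxP X : reflect (X^t* = X) (X \is hermsymmx).
Proof.
rewrite is_hermitianmxE expr0 scale1r eq_sym; exact: eqP.
Qed.

Lemma unitary_diag_hermitian U d : unitary_diag U d \is hermsymmx.
Proof. by apply/hermsymmxP; rewrite !trmxC_mul trmxCK rdiag_adj mulmxA. Qed.

Lemma hermsymmx_lin (I : finType) (t : I -> R) (X : I -> 'M[C]_n) :
  (forall i, X i \is hermsymmx) -> \sum_i (t i)%:C *: X i \is hermsymmx.
Proof.
move=> Xh; apply/hermsymmxP; apply/matrixP => i j.
rewrite !mxE !summxE rmorph_sum; apply: eq_bigr => k _.
have /hermsymmxP/matrixP/(_ i j) := Xh k; rewrite !mxE => XE.
by rewrite rmorphM /= conjC_real XE.
Qed.

Lemma hermsymmxD X Y : X \is hermsymmx -> Y \is hermsymmx -> X + Y \is hermsymmx.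
Proof.
move=> /hermsymmxP hX /hermsymmxP hY; apply/hermsymmxP.
by rewrite linearD /= map_mxD hX hY.
Qed.

Definition real_spectrum X : 'rV[R]_n := map_mx (@complex.Re R) (spectral_diag X).

Lemma hermsymmx_spectral X : X \is hermsymmx ->
  X = unitary_diag (spectralmx X) (real_spectrum X).
Proof.
move=> Xh; have /hermitian_normalmx/orthomx_spectralP := Xh.
have -> : diag_mx (spectral_diag X) = rdiag (real_spectrum X).
  rewrite /rdiag; apply: congr1; apply/rowP => i; rewrite 2!mxE.
  have /mxOverP/(_ 0 i) := hermitian_spectral_diag_real Xh.
  by case: (spectral_diag X 0 i) => a b; rewrite complex_real /= => /eqP ->.
by rewrite (invmx_unitary (spectral_unitarymx X)).
Qed.

Lemma spectral_funE f X :
  spectral_fun f X = unitary_diag (spectralmx X) (map_mx f (real_spectrum X)).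
Proof.
rewrite /spectral_fun /unitary_diag /rdiag.
suff -> : map_mx (real_complex R) (map_mx f (real_spectrum X)) =
  map_mx (fun z => (f (complex.Re z))%:C) (spectral_diag X) by [].
by apply/rowP => i; rewrite !mxE.
Qed.

Lemma unitary_diag_conj U V d i : 
  (U *m unitary_diag V d *m U^t*) i i = (\sum_j sqmod ((U *m V^t*) i j) * d 0 j)%:C.
Proof.
have -> : U *m unitary_diag V d *m U^t* = (U *m V^t*) *m rdiag d *m (U *m V^t*)^t*.
  by rewrite trmxC_mul trmxCK /unitary_diag !mulmxA.
set W := U *m _; rewrite mul_mx_diag mxE rmorph_sum; apply: eq_bigr => j _.
by rewrite !mxE mulrAC mul_conjC_sqmod rmorphM.
Qed.

Lemma retr_sandwich W m a :
  retr (rdiag m *m W *m rdiag a *m W^t*) =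
  \sum_i \sum_j sqmod (W i j) * m 0 i * a 0 j.
Proof.
rewrite /retr /mxtrace Re_sum; apply: eq_bigr => i _.
rewrite mxE Re_sum; apply: eq_bigr => j _.
rewrite mul_mx_diag mul_diag_mx !mxE.
have -> : (m 0 i)%:C * W i j * (a 0 j)%:C * Num.conj (W i j) =
    (m 0 i)%:C * ((a 0 j)%:C * (W i j * Num.conj (W i j))).
  by ring.
by rewrite mul_conjC_sqmod !ReZ /=; ring.
Qed.

Lemma retr_mul_unitary_diag U V m a :
  retr (unitary_diag U m *m unitary_diag V a) =
  \sum_i \sum_j sqmod ((U *m V^t*) i j) * m 0 i * a 0 j.
Proof.
rewrite -retr_sandwich /retr trmxC_mul trmxCK; congr complex.Re.
exact: mxtrace_mul6.
Qed.

(** The row sums are the diagonal entries of [W W^* = 1] for [W = U V^*]; the column sums are row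
    sums for the adjoint [V U^*]. *)
Lemma unitary_doubly_stochastic U V : U \is unitarymx -> V \is unitarymx ->
  doubly_stochastic (\matrix_(i, j) sqmod ((U *m V^t*) i j)).
Proof.
move=> Uu Vu.
have rows X Y : X \is unitarymx -> Y \is unitarymx ->
    forall i, \sum_j sqmod ((X *m Y^t*) i j) = 1.
  move=> Xu Yu i.
  have W1 : (X *m Y^t*) *m (X *m Y^t*)^t* = 1%:M.
    rewrite trmxC_mul trmxCK mulmxA -(mulmxA X) (unitary_mulmxVt Yu) mulmx1.
    exact: unitary_mulmxtV.
  have := congr1 (fun A : 'M[C]_n => A i i) W1.
  rewrite mxE [RHS]mxE eqxx mulr1n => sum1.
  suff : (\sum_j sqmod ((X *m Y^t*) i j))%:C = 1 :> C by case.
  rewrite -sum1 rmorph_sum; apply: eq_bigr => j _ /=; rewrite -mul_conjC_sqmod.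
  by congr (_ * _); rewrite !mxE.
split=> [i j | i | j]; first by rewrite mxE sqmod_ge0.
  by under eq_bigr do rewrite mxE; exact: rows.
under eq_bigr do rewrite mxE; rewrite -[RHS](rows V U Vu Uu j).
apply: eq_bigr => i _; have -> : V *m U^t* = (U *m V^t*)^t* by rewrite trmxC_mul trmxCK.
by rewrite [in RHS]mxE [in RHS]mxE sqmod_conjC.
Qed.

Lemma unitary_diagK U d : U \is unitarymx ->
  U *m unitary_diag U d *m U^t* = rdiag d.
Proof.
move=> Uu; rewrite /unitary_diag !mulmxA unitary_mulmxtV // mul1mx.
by rewrite -mulmxA unitary_mulmxtV // mulmx1.
Qed.

(** The eigenvalue is the value of the quadratic form at the [i]-th row of [spectralmx X], which is
    a unit vector. *)
Lemma posdefmx_spectrum_gt0 X i : posdefmx X -> 0 < real_spectrum X 0 i.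
Proof.
move=> [Xh Xpos]; set U := spectralmx X.
have Uu : U \is unitarymx by exact: spectral_unitarymx.
have : row i U != 0.
  apply/eqP => Ui0; have := congr1 (fun A : 'M[C]_n => A i i) (unitary_mulmxtV Uu).
  have /rowP Ui := Ui0; rewrite !mxE eqxx big1 => [/eqP|j _].
    by rewrite eq_sym oner_eq0.
  by have := Ui j; rewrite !mxE => ->; rewrite mul0r.
move=> /Xpos.
have -> : row i U *m X *m (row i U)^t* = row i (col i (U *m X *m U^t*)).
  rewrite -row_mul; apply/matrixP => k l.
  by rewrite !mxE; apply: eq_bigr => j _; rewrite !mxE.
rewrite mxE mxE.
have -> : U *m X *m U^t* = rdiag (real_spectrum X).
  by rewrite [in LHS](hermsymmx_spectral Xh) unitary_diagK.
by rewrite !mxE eqxx mulr1n ltcR.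
Qed.

Lemma posdefmx_convex (X Y : 'M[C]_n) (t : R) : 0 <= t <= 1 -> posdefmx X -> posdefmx Y ->
  posdefmx (t%:C *: X + (1 - t)%:C *: Y).
Proof.
move=> /andP[t0 t1] [Xh Xpos] [Yh Ypos]; split.
  have := @hermsymmx_lin bool (fun b => if b then t else 1 - t)
    (fun b => if b then X else Y).
  by rewrite big_bool /=; apply => -[].
move=> v v0; rewrite mulmxDr mulmxDl -!scalemxAr -!scalemxAl !mxE.
move: (Xpos v v0) (Ypos v v0); rewrite !mxE => {}Xpos {}Ypos.
move: t0 t1; rewrite le_eqVlt => /predU1P[<- _ | t0].
  by rewrite subr0 rmorph0 rmorph1 mul0r add0r mul1r.
rewrite -subr_ge0 => t1; rewrite ltr_wpDr ?mulr_gt0 ?ltcR //.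
by rewrite mulr_ge0 ?lecR // ltW.
Qed.

(** Two diagonalizations of one matrix share the characteristic polynomial, so their diagonals agree
    up to order. A symmetric form can thus be evaluated on any diagonalization. *)
Lemma eigvals_unitary_diag U d : U \is unitarymx ->
  exists s : 'S_n, eigvals (unitary_diag U d) = col_perm s d.
Proof.
move=> Uu; set X := unitary_diag U d.
have Xh : X \is hermsymmx by exact: unitary_diag_hermitian.
have char_poly_diag V e : V \is unitarymx ->
    char_poly (unitary_diag V e) =
    \prod_(x <- [seq (e 0 i)%:C | i <- enum 'I_n]) ('X - x%:P).
  move=> Vu; have -> : char_poly (unitary_diag V e) = char_poly (rdiag e).
    rewrite /char_poly; have VV := unitary_mulmxVt Vu.
    have -> : char_poly_mx (unitary_diag V e) =
        map_mx polyC (V^t*) *m char_poly_mx (rdiag e) *m map_mx polyC V.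
      rewrite /char_poly_mx mulmxBr mulmxBl -!map_mxM; congr (_ - _).
      by rewrite scalar_mxC -mulmxA -map_mxM /= VV map_mx1 mulmx1.
    rewrite !det_mulmx mulrC mulrA -det_mulmx -map_mxM.
    by rewrite unitary_mulmxtV // map_mx1 det1 mul1r.
  rewrite char_poly_trig ?diag_mx_is_trig // big_map enumT; apply: eq_bigr => i _.
  by rewrite !mxE eqxx.
have tupleE : [seq d 0 i | i <- enum 'I_n] = [tuple d 0 i | i < n].
  exact: (congr1 (map (fun i => d 0 i)) (esym (val_ord_tuple n))).
have ReE (e : 'rV[R]_n) (r : seq 'I_n) :
    [seq complex.Re x | x <- [seq (e 0 i)%:C | i <- r]] = [seq e 0 i | i <- r].
  by elim: r => //= i r ->.
have perm_spec : perm_eq [seq real_spectrum X 0 i | i <- enum 'I_n] [tuple d 0 i | i < n].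
  have := char_poly_diag _ (real_spectrum X) (spectral_unitarymx X).
  rewrite -hermsymmx_spectral // char_poly_diag // => /prod_XsubC_eq.
  by move=> /(perm_map (@complex.Re R)); rewrite !ReE tupleE perm_sym.
have : perm_eq (sort >=%R [seq complex.Re (spectral_diag X 0 j) | j <- enum 'I_n])
    [tuple d 0 i | i < n].
  rewrite perm_sort -(eq_map (f := fun i => real_spectrum X 0 i)) // => i.
  by rewrite mxE.
move=> /tuple_permP[s E]; exists s; apply/rowP => i.
by rewrite !mxE E -(tnth_nth 0) tnth_mktuple tnth_mktuple.
Qed.

End SpectralForm.

(** * Joint convexity of the relative entropy *)

Section TraceConjugation.
Variables (K : comNzRingType) (n : nat) (U U' V V' : 'M[K]_n).
Hypotheses (UU' : U *m U' = 1%:M) (VV' : V *m V' = 1%:M).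

Lemma mxtrace_conj2 (D P : 'M[K]_n) :
  \tr ((U' *m D *m U) *m (U' *m P *m V)) = \tr (D *m P *m (V *m U')).
Proof.
by rewrite -!mulmxA (mulmxA U U') UU' mul1mx mxtrace_mulC !mulmxA.
Qed.

Lemma mxtrace_conj3l (P E Q : 'M[K]_n) :
  \tr ((U' *m P *m V) *m (V' *m E *m V) *m (V' *m Q *m U)) = \tr (P *m E *m Q).
Proof.
rewrite -!mulmxA (mulmxA V V' (E *m _)) VV' mul1mx (mulmxA V V') VV' mul1mx.
by rewrite mxtrace_mulC -!mulmxA UU' mulmx1.
Qed.

Lemma mxtrace_conj3r (P Q D : 'M[K]_n) :
  \tr ((U' *m P *m V) *m (V' *m Q *m U) *m (U' *m D *m U)) = \tr (P *m Q *m D).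
Proof.
rewrite -!mulmxA (mulmxA V V') VV' mul1mx (mulmxA U U') UU' mul1mx.
by rewrite mxtrace_mulC -!mulmxA UU' mulmx1.
Qed.

End TraceConjugation.

(** * Relative entropy through resolvent forms *)

Section RelativeEntropy.
Variables (R : realType) (n : nat).
Notation C := R[i].
Implicit Types (X Y Z U V P M A : 'M[C]_n) (d m a : 'rV[R]_n) (s : R).

Definition overlap U V : 'M[R]_n := \matrix_(i, j) sqmod ((U *m V^t*) i j).

(* tr M (ln M - ln A) for M = U^* diag(m) U and A = V^* diag(a) V. *)
Definition relative_entropy U m V a : R :=
  \sum_i \sum_j overlap U V i j * m 0 i * (ln (m 0 i) - ln (a 0 j)).

(* <M, (L_A + s R_M)^-1 M>, where L_A and R_M are the left multiplication by A
   and the right multiplication by M; it is the maximum over Z of the functional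
   below, which is linear in (M, A). *)
Definition resolvent_form s U m V a : R :=
  \sum_i \sum_j overlap U V i j * m 0 i ^+ 2 / (a 0 j + s * m 0 i).

Definition resolvent_functional s Z M A : R :=
  2 * retr (M *m Z) - retr (Z *m A *m Z^t*) - s * retr (Z *m Z^t* *m M).

Lemma retr_rdiag_mul P X d :
  retr (rdiag d *m P *m X^t*) =
  \sum_i \sum_j d 0 i * complex.Re (P i j * Num.conj (X i j)).
Proof.
rewrite /retr /mxtrace Re_sum; apply: eq_bigr => i _.
rewrite mxE Re_sum; apply: eq_bigr => j _.
by rewrite mul_diag_mx !mxE -mulrA ReZ.
Qed.

Lemma retr_sandwich_rdiag P d :
  retr (P *m rdiag d *m P^t*) = \sum_i \sum_j sqmod (P i j) * d 0 j.
Proof.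
rewrite /retr /mxtrace Re_sum; apply: eq_bigr => i _.
rewrite mxE Re_sum; apply: eq_bigr => j _.
by rewrite mul_mx_diag !mxE mulrAC mul_conjC_sqmod mulrC ReZ mulrC.
Qed.

Lemma retr_gram_rdiag P d :
  retr (P *m P^t* *m rdiag d) = \sum_i \sum_j sqmod (P i j) * d 0 i.
Proof.
rewrite /retr mxtrace_mulC mulmxA -/(retr _) retr_rdiag_mul.
by apply: eq_bigr => i _; apply: eq_bigr => j _; rewrite mul_conjC_sqmod mulrC.
Qed.

(** In coordinates adapted to both eigenbases the functional splits into one quadratic function of
    each entry [P i j]. *)
Lemma resolvent_functionalE s P U m V a : U \is unitarymx -> V \is unitarymx ->
  resolvent_functional s (U^t* *m P *m V) (unitary_diag U m) (unitary_diag V a) =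
  \sum_i \sum_j (2 * m 0 i * complex.Re (P i j * Num.conj ((U *m V^t*) i j)) -
     (a 0 j + s * m 0 i) * sqmod (P i j)).
Proof.
move=> Uu Vu; have UU := unitary_mulmxtV Uu; have VV := unitary_mulmxtV Vu.
have adjP : (U^t* *m P *m V)^t* = V^t* *m P^t* *m U.
  by rewrite !trmxC_mul trmxCK mulmxA.
rewrite /resolvent_functional adjP.
have gen (U' V' P' D E : 'M[C]_n) : U *m U' = 1%:M -> V *m V' = 1%:M ->
    2 * retr (U' *m D *m U *m (U' *m P *m V)) -
    retr (U' *m P *m V *m (V' *m E *m V) *m (V' *m P' *m U)) -
    s * retr (U' *m P *m V *m (V' *m P' *m U) *m (U' *m D *m U)) =
    2 * retr (D *m P *m (V *m U')) - retr (P *m E *m P') - s * retr (P *m P' *m D).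
  by move=> ? ?; rewrite /retr mxtrace_conj2 // mxtrace_conj3l // mxtrace_conj3r.
rewrite gen //; have -> : V *m U^t* = (U *m V^t*)^t* by rewrite trmxC_mul trmxCK.
rewrite retr_rdiag_mul retr_sandwich_rdiag retr_gram_rdiag.
rewrite !mulr_sumr -!sumrB; apply: eq_bigr => i _.
rewrite !mulr_sumr -!sumrB; apply: eq_bigr => j _; ring.
Qed.

Lemma resolvent_functional_le s Z U m V a : 0 < s ->
  U \is unitarymx -> V \is unitarymx ->
  (forall i, 0 < m 0 i) -> (forall i, 0 < a 0 i) ->
  resolvent_functional s Z (unitary_diag U m) (unitary_diag V a) <=
  resolvent_form s U m V a.
Proof.
move=> s0 Uu Vu m0 a0.
have -> : Z = U^t* *m (U *m Z *m V^t*) *m V.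
  rewrite -!mulmxA (unitary_mulmxVt Vu) mulmx1 !mulmxA (unitary_mulmxVt Uu).
  by rewrite mul1mx.
rewrite resolvent_functionalE //; move: (U *m Z *m V^t*) => P.
apply: ler_sum => i _; apply: ler_sum => j _; rewrite [overlap _ _ _ _]mxE.
move: ((U *m V^t*) i j) (P i j) => w z.
have c0 : 0 < a 0 j + s * m 0 i by rewrite addr_gt0 // mulr_gt0.
move: (a 0 j + s * m 0 i) c0 => c c0; move: (m 0 i) => mi.
rewrite ler_pdivlMr // -subr_ge0.
(* Completing the square: the gap, multiplied by [c], is [|mi w - c z|^2]. *)
suff -> : sqmod w * mi ^+ 2 - (2 * mi * complex.Re (z * Num.conj w) - c * sqmod z) * c
  = (mi * complex.Re w - c * complex.Re z) ^+ 2 +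
    (mi * complex.Im w - c * complex.Im z) ^+ 2.
  by rewrite addr_ge0 // sqr_ge0.
by case: w z => [w1 w2] [z1 z2]; rewrite /sqmod /=; ring.
Qed.

Lemma resolvent_functional_max s U m V a : 0 < s ->
  U \is unitarymx -> V \is unitarymx ->
  (forall i, 0 < m 0 i) -> (forall i, 0 < a 0 i) ->
  exists Z, resolvent_functional s Z (unitary_diag U m) (unitary_diag V a) =
    resolvent_form s U m V a.
Proof.
move=> s0 Uu Vu m0 a0.
(* The entries at which the completed squares vanish. *)
pose P : 'M[C]_n := \matrix_(i, j) ((m 0 i / (a 0 j + s * m 0 i))%:C * (U *m V^t*) i j).
exists (U^t* *m P *m V); rewrite resolvent_functionalE //.
apply: eq_bigr => i _; apply: eq_bigr => j _; rewrite [overlap _ _ _ _]mxE [P _ _]mxE.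
move: ((U *m V^t*) i j) => w.
have : a 0 j + s * m 0 i != 0 by rewrite gt_eqF // addr_gt0 // mulr_gt0.
move: (a 0 j + s * m 0 i) => c c0; move: (m 0 i) => mi.
by case: w => [w1 w2]; rewrite /sqmod /=; field.
Qed.

Lemma resolvent_functional_lin (I : finType) (t : I -> R) (M A : I -> 'M[C]_n) s Z :
  resolvent_functional s Z (\sum_k (t k)%:C *: M k) (\sum_k (t k)%:C *: A k) =
  \sum_k t k * resolvent_functional s Z (M k) (A k).
Proof.
rewrite /resolvent_functional mulmx_suml !mulmx_sumr mulmx_suml.
under eq_bigr do rewrite -scalemxAl.
under [X in _ - retr X - _]eq_bigr do rewrite -scalemxAr -scalemxAl.
under [X in _ - _ * retr X]eq_bigr do rewrite -scalemxAr.
rewrite !retr_lin !mulr_sumr -!sumrB; apply: eq_bigr => k _; ring.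
Qed.

(** A maximum of functionals linear in [(M, A)] is convex: take the maximizer [Z] of the mixture and
    use it as a competitor for each component. *)
Lemma resolvent_form_convex (I : finType) (t : I -> R) s
    (U V : I -> 'M[C]_n) (m a : I -> 'rV[R]_n) U0 V0 m0 a0 :
  0 < s -> (forall k, 0 <= t k) ->
  (forall k, U k \is unitarymx) -> (forall k, V k \is unitarymx) ->
  U0 \is unitarymx -> V0 \is unitarymx ->
  (forall k i, 0 < m k 0 i) -> (forall k i, 0 < a k 0 i) ->
  (forall i, 0 < m0 0 i) -> (forall i, 0 < a0 0 i) ->
  unitary_diag U0 m0 = \sum_k (t k)%:C *: unitary_diag (U k) (m k) ->
  unitary_diag V0 a0 = \sum_k (t k)%:C *: unitary_diag (V k) (a k) ->
  resolvent_form s U0 m0 V0 a0 <= \sum_k t k * resolvent_form s (U k) (m k) (V k) (a k).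
Proof.
move=> s0 t_ge0 Uu Vu U0u V0u m_gt0 a_gt0 m0_gt0 a0_gt0 E1 E2.
have [Z <-] := resolvent_functional_max s0 U0u V0u m0_gt0 a0_gt0.
rewrite E1 E2 resolvent_functional_lin; apply: ler_sum => k _.
apply: ler_wpM2l; first exact: t_ge0.
exact: (resolvent_functional_le Z s0 (Uu k) (Vu k) (m_gt0 k) (a_gt0 k)).
Qed.

Lemma trace_unitary_diag U m : U \is unitarymx ->
  retr (unitary_diag U m) = \sum_i m 0 i.
Proof.
move=> Uu; rewrite /retr /unitary_diag mxtrace_mulC mulmxA unitary_mulmxtV // mul1mx.
by rewrite mxtrace_diag Re_sum; apply: eq_bigr => i _; rewrite mxE.
Qed.

Lemma sum_overlap U V (f : 'I_n -> R) : U \is unitarymx -> V \is unitarymx ->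
  \sum_i \sum_j overlap U V i j * f i = \sum_i f i.
Proof.
move=> Uu Vu; have [_ rows _] := unitary_doubly_stochastic Uu Vu.
by apply: eq_bigr => i _; rewrite -mulr_suml rows mul1r.
Qed.

(** The mixture (index [None], weight -1) and its components ([Some k], weight [t k]) are merged
    into one sum of terms [c * ln r] with [r = a / m], to which [sum_mul_ln_le0] applies. The [c]
    sum to 0 by linearity of the trace, and the sum of the [c / (r + s)] is the convexity gap of the
    resolvent form. *)
Lemma relative_entropy_convex (I : finType) (t : I -> R)
    (U V : I -> 'M[C]_n) (m a : I -> 'rV[R]_n) U0 V0 m0 a0 :
  (forall k, 0 <= t k) ->
  (forall k, U k \is unitarymx) -> (forall k, V k \is unitarymx) ->
  U0 \is unitarymx -> V0 \is unitarymx ->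
  (forall k i, 0 < m k 0 i) -> (forall k i, 0 < a k 0 i) ->
  (forall i, 0 < m0 0 i) -> (forall i, 0 < a0 0 i) ->
  unitary_diag U0 m0 = \sum_k (t k)%:C *: unitary_diag (U k) (m k) ->
  unitary_diag V0 a0 = \sum_k (t k)%:C *: unitary_diag (V k) (a k) ->
  relative_entropy U0 m0 V0 a0 <= \sum_k t k * relative_entropy (U k) (m k) (V k) (a k).
Proof.
move=> t_ge0 Uu Vu U0u V0u m_gt0 a_gt0 m0_gt0 a0_gt0 E1 E2.
pose oU o := oapp U U0 o; pose oV o := oapp V V0 o.
pose om o := oapp m m0 o; pose oa o := oapp a a0 o; pose ot o := oapp t (- 1) o.
have sum_option (f : option I -> R) : \sum_o f o = f None + \sum_k f (Some k).
  rewrite (bigD1 None) //= (reindex_omap Some id) //= => [|[k|]//].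
  by congr (_ + _); apply: eq_bigl => k; rewrite eqxx.
have om_gt0 o i : 0 < om o 0 i by case: o => [k|]; [exact: m_gt0 | exact: m0_gt0].
have oa_gt0 o i : 0 < oa o 0 i by case: o => [k|]; [exact: a_gt0 | exact: a0_gt0].
have oUu o : oU o \is unitarymx by case: o => [k|]; [exact: Uu | exact: U0u].
have oVu o : oV o \is unitarymx by case: o => [k|]; [exact: Vu | exact: V0u].
pose c (x : option I * ('I_n * 'I_n)) :=
  ot x.1 * (overlap (oU x.1) (oV x.1) x.2.1 x.2.2 * om x.1 0 x.2.1).
pose r (x : option I * ('I_n * 'I_n)) := oa x.1 0 x.2.2 / om x.1 0 x.2.1.
have sum3 (f : option I -> R) (F : option I -> 'I_n -> 'I_n -> R)
    (G : option I * ('I_n * 'I_n) -> R) :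
    (forall o i j, G (o, (i, j)) = f o * F o i j) ->
    \sum_x G x = \sum_o f o * \sum_i \sum_j F o i j.
  move=> GF; transitivity (\sum_x G (x.1, x.2)); first by apply: eq_bigr => -[].
  rewrite -(pair_bigA _ (fun o ij => G (o, ij))) /=; apply: eq_bigr => o _.
  transitivity (\sum_x G (o, (x.1, x.2))); first by apply: eq_bigr => -[].
  rewrite -(pair_bigA _ (fun i j => G (o, (i, j)))) /= mulr_sumr.
  by apply: eq_bigr => i _; rewrite mulr_sumr; apply: eq_bigr.
have r_gt0 x : 0 < r x by rewrite divr_gt0.
have := sum_mul_ln_le0 (c := c) r_gt0.
have -> : \sum_x c x * ln (r x) = relative_entropy U0 m0 V0 a0 -
    \sum_k t k * relative_entropy (U k) (m k) (V k) (a k).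
  transitivity (\sum_o - ot o * relative_entropy (oU o) (om o) (oV o) (oa o)).
    by apply: sum3 => o i j; rewrite /c /r /= ln_div ?posrE //; ring.
  rewrite sum_option /= opprK mul1r -sumrN; congr (_ + _).
  by apply: eq_bigr => k _; rewrite mulNr.
rewrite subr_le0; apply.
  rewrite (sum3 ot (fun o i j => overlap (oU o) (oV o) i j * om o 0 i)) //.
  transitivity (\sum_o ot o * retr (unitary_diag (oU o) (om o))).
    apply: eq_bigr => o _; congr (_ * _); rewrite (trace_unitary_diag _ (oUu o)).
    exact: (sum_overlap (fun i => om o 0 i) (oUu o) (oVu o)).
  by rewrite sum_option /= E1 retr_lin mulN1r addNr.
move=> s s0; rewrite (sum3 ot (fun o i j =>
    overlap (oU o) (oV o) i j * om o 0 i ^+ 2 / (oa o 0 j + s * om o 0 i))).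
  rewrite sum_option /= mulN1r addrC subr_ge0.
  exact: resolvent_form_convex.
move=> o i j; rewrite /c /r /=; have := om_gt0 o i; have := oa_gt0 o j.
move: (om o 0 i) (oa o 0 j) => x y y0 x0; field.
by rewrite !gt_eqF // addr_gt0 // mulr_gt0.
Qed.

End RelativeEntropy.

Section EntropyIdentities.
Variables (R : realType) (n : nat).
Notation C := R[i].
Implicit Types (X Y Z U V P M A : 'M[C]_n) (d m a : 'rV[R]_n) (s : R).

Definition entropy_sum m : R := \sum_i m 0 i * ln (m 0 i).

Lemma retr_mul_same U m d : U \is unitarymx ->
  retr (unitary_diag U m *m unitary_diag U d) = \sum_i m 0 i * d 0 i.
Proof.
move=> Uu; rewrite retr_mul_unitary_diag unitary_mulmxtV //.
apply: eq_bigr => i _; rewrite (bigD1 i) //= big1 => [|j /negbTE ji].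
  by rewrite mxE eqxx /sqmod /= expr0n expr1n !addr0 mul1r.
by rewrite mxE eq_sym ji /sqmod /= expr0n addr0 !mul0r.
Qed.

Lemma relative_entropyE U V m a : U \is unitarymx -> V \is unitarymx ->
  relative_entropy U m V a =
  entropy_sum m - retr (unitary_diag U m *m unitary_diag V (map_mx (@ln R) a)).
Proof.
move=> Uu Vu; rewrite retr_mul_unitary_diag /entropy_sum.
rewrite -(sum_overlap (fun i => m 0 i * ln (m 0 i)) Uu Vu) -sumrB.
apply: eq_bigr => i _; rewrite -sumrB; apply: eq_bigr => j _.
by rewrite [overlap _ _ _ _]mxE [map_mx _ a _ _]mxE mulrBr mulrA.
Qed.

Lemma unitary_diag_const1 U : U \is unitarymx -> unitary_diag U (const_mx 1) = 1%:M.
Proof.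
move=> Uu; rewrite /unitary_diag.
have -> : rdiag (const_mx 1 : 'rV[R]_n) = 1%:M.
  by rewrite /rdiag map_const_mx rmorph1 diag_const_mx.
by rewrite mulmx1 unitary_mulmxVt.
Qed.

(** Relative entropy with respect to the identity, which is preserved by mixtures of total weight
    1. *)
Lemma entropy_sum_convex (I : finType) (t : I -> R) (U : I -> 'M[C]_n)
    (m : I -> 'rV[R]_n) U0 m0 :
  (forall k, 0 <= t k) -> \sum_k t k = 1 ->
  (forall k, U k \is unitarymx) -> U0 \is unitarymx ->
  (forall k i, 0 < m k 0 i) -> (forall i, 0 < m0 0 i) ->
  unitary_diag U0 m0 = \sum_k (t k)%:C *: unitary_diag (U k) (m k) ->
  entropy_sum m0 <= \sum_k t k * entropy_sum (m k).
Proof.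
move=> t_ge0 t1 Uu U0u m_gt0 m0_gt0 E.
have reE V x : V \is unitarymx -> relative_entropy V x V (const_mx 1) = entropy_sum x.
  move=> Vu; rewrite relative_entropyE // retr_mul_same // big1 ?subr0 // => i _.
  by rewrite !mxE ln1 mulr0.
rewrite -(reE U0 m0 U0u); under eq_bigr => k _ do rewrite -(reE (U k) (m k) (Uu k)).
apply: (relative_entropy_convex t_ge0 Uu Uu U0u U0u m_gt0 _ m0_gt0 _ E).
- by move=> k i; rewrite mxE.
- by move=> i; rewrite mxE.
rewrite (unitary_diag_const1 U0u).
under eq_bigr => k _ do rewrite (unitary_diag_const1 (Uu k)).
by rewrite -scaler_suml -rmorph_sum t1 rmorph1 scale1r.
Qed.

End EntropyIdentities.

(** * Gibbs variational inequality and concavity *)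

Section LogTangentForms.
Variables (R : realType) (n : nat) (psi : 'rV[R]_n -> R).
Implicit Types (x y a b c w m z : 'rV[R]_n) (D : 'M[R]_n).
Hypothesis psi_perm : forall (s : 'S_n) x, nneg_orthant x -> psi (col_perm s x) = psi x.

(** The log-subgradient inequality at [e^y'] is tested on a permutation of [e^y]; rearrangement
    supplies one for which the linear term is nonnegative. *)
Lemma log_tangent_schur D y w :
  doubly_stochastic D ->
  let y' := \row_i \sum_j D i j * y 0 j in
  log_tangent psi (map_mx (@expR R) y') w ->
  psi (map_mx (@expR R) y') <= psi (map_mx (@expR R) y).
Proof.
move=> Dds y' [_ _ wsub]; set z := map_mx _ y' in wsub *.
pose g := \row_i (w 0 i * z 0 i).
have [s gs] := doubly_stochastic_rearrangement g y Dds.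
rewrite -[X in _ <= X](psi_perm s); last by move=> i; rewrite mxE expR_ge0.
have c0 i : 0 < col_perm s (map_mx (@expR R) y) 0 i by rewrite !mxE expR_gt0.
rewrite (le_trans _ (wsub _ c0)) // lerDl.
have -> : \sum_i w 0 i * z 0 i * (ln (col_perm s (map_mx (@expR R) y) 0 i) - ln (z 0 i)) =
    \sum_i g 0 i * y 0 (s i) - \sum_i \sum_j g 0 i * D i j * y 0 j.
  rewrite -sumrB; apply: eq_bigr => i _; rewrite [g]lock !mxE !expRK -lock mulrBr !mxE.
  by congr (_ - _); rewrite mulr_sumr; apply: eq_bigr => j _; rewrite mulrA.
by rewrite subr_ge0.
Qed.

(** The test vector [c] is a permutation of [m] times [b]. The supergradient [w'] bounds [psi c]
    above, and the log-tangent at [a] bounds it below after undoing the permutation. Rearrangement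
    with the gain [ln b - w' b] chooses the permutation so that it may be replaced by [D]. *)
Lemma log_tangent_transport D a w w' b m :
  doubly_stochastic D -> (forall i, 0 < a 0 i) -> (forall i, 0 < w 0 i) ->
  (forall i, 0 < b 0 i) -> log_tangent psi a w ->
  (forall c, nneg_orthant c -> psi c <= \sum_i w' 0 i * c 0 i) ->
  (forall i, m 0 i = w 0 i * a 0 i) ->
  psi a + \sum_i m 0 i * (ln (m 0 i) - ln (a 0 i)) +
    \sum_i ln (b 0 i) * \sum_j D i j * m 0 j <=
  \sum_i w' 0 i * b 0 i * \sum_j D i j * m 0 j.
Proof.
move=> Dds a0 w0 b0 [_ _ wsub] w'sup mE.
have m0 i : 0 < m 0 i by rewrite mE mulr_gt0.
pose g := \row_i (ln (b 0 i) - w' 0 i * b 0 i).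
have [s gs] := doubly_stochastic_rearrangement g m Dds.
pose c := \row_i (m 0 (s i) * b 0 i).
have c_ge0 : nneg_orthant c by move=> i; rewrite mxE mulr_ge0 // ltW.
pose c' := col_perm s^-1 c.
have c'E i : c' 0 i = m 0 i * b 0 (s^-1 i)%g by rewrite !mxE permKV.
have c'0 i : 0 < c' 0 i by rewrite c'E mulr_gt0.
have := w'sup c c_ge0; rewrite -(psi_perm s^-1 c_ge0) => H1.
have {H1} := le_trans (wsub c' c'0) H1.
have -> : \sum_i w 0 i * a 0 i * (ln (c' 0 i) - ln (a 0 i)) =
    \sum_i m 0 i * (ln (m 0 i) - ln (a 0 i)) + \sum_i m 0 (s i) * ln (b 0 i).
  rewrite [X in _ = _ + X](reindex_inj (@perm_inj _ s^-1)) /= -big_split.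
  apply: eq_bigr => i _; rewrite c'E permKV lnM ?posrE //=.
  by rewrite -mE; ring.
have -> : \sum_i w' 0 i * c 0 i = \sum_i w' 0 i * b 0 i * m 0 (s i).
  by apply: eq_bigr => i _; rewrite [c _ _]mxE mulrCA mulrA mulrC mulrA; ring.
move: gs.
have -> : \sum_i \sum_j g 0 i * D i j * m 0 j =
  \sum_i ln (b 0 i) * (\sum_j D i j * m 0 j) -
  \sum_i w' 0 i * b 0 i * \sum_j D i j * m 0 j.
  rewrite -sumrB; apply: eq_bigr => i _; rewrite -mulrBl mulr_sumr [g _ _]mxE.
  by apply: eq_bigr => j _; rewrite mulrA.
have -> : \sum_i g 0 i * m 0 (s i) =
    \sum_i m 0 (s i) * ln (b 0 i) - \sum_i w' 0 i * b 0 i * m 0 (s i).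
  by rewrite -sumrB; apply: eq_bigr => i _; rewrite [g _ _]mxE; ring.
lra.
Qed.

Lemma form_mx_exp (Y : 'M[R[i]]_n) :
  form_mx psi (mxexp Y) = psi (map_mx (@expR R) (real_spectrum Y)).
Proof.
rewrite /form_mx /mxexp spectral_funE.
have [s ->] := eigvals_unitary_diag (map_mx (@expR R) (real_spectrum Y))
  (spectral_unitarymx Y).
by rewrite psi_perm // => i; rewrite mxE expR_ge0.
Qed.

End LogTangentForms.

Lemma convex_comb_gt0 (R : realType) (I : finType) (t x : I -> R) :
  (forall k, 0 <= t k) -> \sum_k t k = 1 -> (forall k, 0 < x k) ->
  0 < \sum_k t k * x k.
Proof.
move=> t_ge0 t1 x_gt0; have tx_ge0 k : 0 <= t k * x k by rewrite mulr_ge0 // ltW.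
rewrite lt_def sumr_ge0 // andbT; apply/eqP => /psumr_eq0P tx0.
have := oner_neq0 R; rewrite -t1 big1 ?eqxx // => k _.
have /eqP := tx0 (fun k _ => tx_ge0 k) k isT.
by rewrite mulf_eq0 (gt_eqF (x_gt0 k)) orbF => /eqP.
Qed.

Lemma retr_mulD (R : realType) (n m : nat) (X H : 'M[R[i]]_n) (p : 'I_m -> R)
    (L : 'I_m -> 'M[R[i]]_n) :
  retr (X *m (H + \sum_(j < m) (p j)%:C *: L j)) =
  retr (X *m H) + \sum_(j < m) p j * retr (X *m L j).
Proof.
rewrite mulmxDr retrD mulmx_sumr -retr_lin; congr (_ + retr _).
by apply: eq_bigr => j _; rewrite scalemxAr.
Qed.

Lemma retr_mul_suml (R : realType) (n : nat) (I : finType) (t : I -> R)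
    (X : I -> 'M[R[i]]_n) (H : 'M[R[i]]_n) :
  retr ((\sum_k (t k)%:C *: X k) *m H) = \sum_k t k * retr (X k *m H).
Proof.
rewrite mulmx_suml -retr_lin; congr retr.
by apply: eq_bigr => j _; rewrite scalemxAl.
Qed.

Lemma hermsymmx_diagonalization (R : realType) n (X : 'M[R[i]]_n) :
  X \is hermsymmx ->
  exists U (d : 'rV[R]_n), U \is unitarymx /\ unitary_diag U d = X.
Proof.
move=> Xh; exists (spectralmx X), (real_spectrum X).
by split; [exact: spectral_unitarymx | rewrite -hermsymmx_spectral].
Qed.

Lemma unitary_diag_lin_diag (R : realType) n (I : finType) (t : I -> R)
    (U : I -> 'M[R[i]]_n) (d : I -> 'rV[R]_n) U0 d0 i :
  U0 \is unitarymx ->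
  unitary_diag U0 d0 = \sum_k (t k)%:C *: unitary_diag (U k) (d k) ->
  d0 0 i = \sum_k t k * \sum_j overlap U0 (U k) i j * d k 0 j.
Proof.
move=> U0u E; have : (U0 *m unitary_diag U0 d0 *m U0^t*) i i = (d0 0 i)%:C.
  by rewrite unitary_diagK // !mxE eqxx mulr1n.
rewrite E mulmx_sumr mulmx_suml summxE => {}E.
suff : (d0 0 i)%:C = (\sum_k t k * \sum_j overlap U0 (U k) i j * d k 0 j)%:C by case.
rewrite -E rmorph_sum; apply: eq_bigr => k _.
rewrite -scalemxAr -scalemxAl mxE unitary_diag_conj -rmorphM /=.
by congr ((_ * _)%:C); apply: eq_bigr => j _; rewrite [overlap _ _ _ _]mxE.
Qed.

Lemma posdefmx_log (R : realType) n (B : 'M[R[i]]_n) : posdefmx B ->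
  exists V (b : 'rV[R]_n), [/\ V \is unitarymx, forall i, 0 < b 0 i,
    unitary_diag V b = B & mxlog B = unitary_diag V (map_mx (@ln R) b)].
Proof.
move=> Bpos; exists (spectralmx B), (real_spectrum B).
split; first exact: spectral_unitarymx.
- by move=> i; exact: posdefmx_spectrum_gt0.
- by rewrite -hermsymmx_spectral //; case: Bpos.
- exact: spectral_funE.
Qed.

(** * Concavity for forms with strictly positive log-tangents *)

Section Core.
Variables (R : realType) (n : nat) (psi : 'rV[R]_n -> R).
Hypothesis psi_perm : forall (s : 'S_n) x, nneg_orthant x -> psi (col_perm s x) = psi x.
Hypothesis psi_tangent : forall a : 'rV[R]_n, (forall i, 0 < a 0 i) ->
  exists w : 'rV[R]_n, (forall i, 0 < w 0 i) /\ log_tangent psi a w.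

(** For [psi] the sum of the entries one may take [mu k = e^(y k)], and this is the Gibbs inequality
    [tr M + tr M Y - tr M log M <= tr e^Y]. In general [mu k] is the gradient of [psi(e^u)] at
    [y k]. *)
Lemma log_tangent_gibbs (I : finType) (t : I -> R)
    (U : I -> 'M[R[i]]_n) (y : I -> 'rV[R]_n) (V : 'M[R[i]]_n) (y0 : 'rV[R]_n) :
  (forall k, 0 <= t k) -> \sum_k t k = 1 ->
  (forall k, U k \is unitarymx) -> V \is unitarymx ->
  exists (mu : I -> 'rV[R]_n) (U0 : 'M[R[i]]_n) (mu0 : 'rV[R]_n),
  [/\ U0 \is unitarymx, forall k i, 0 < mu k 0 i, forall i, 0 < mu0 0 i,
      unitary_diag U0 mu0 = \sum_k (t k)%:C *: unitary_diag (U k) (mu k) &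
      \sum_k t k * (psi (map_mx (@expR R) (y k)) + entropy_sum (mu k) -
         retr (unitary_diag (U k) (mu k) *m unitary_diag (U k) (y k))) +
      (retr (unitary_diag U0 mu0 *m unitary_diag V y0) - entropy_sum mu0) <=
      psi (map_mx (@expR R) y0)].
Proof.
move=> t_ge0 t1 Uu Vu; pose a k := map_mx (@expR R) (y k).
have a_gt0 k i : 0 < a k 0 i by rewrite mxE expR_gt0.
have [w wP] := choice (fun k => psi_tangent (a_gt0 k)).
pose mu k := \row_i (w k 0 i * a k 0 i).
have muE k i : mu k 0 i = w k 0 i * a k 0 i by rewrite mxE.
have mu_gt0 k i : 0 < mu k 0 i by rewrite muE mulr_gt0 // (proj1 (wP k)).
have Mh : \sum_k (t k)%:C *: unitary_diag (U k) (mu k) \is hermsymmx.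
  by apply: hermsymmx_lin => k; exact: unitary_diag_hermitian.
have [U0 [mu0 [U0u ME]]] := hermsymmx_diagonalization Mh.
exists mu, U0, mu0.
have mu0E i := unitary_diag_lin_diag i U0u ME.
have ds k : doubly_stochastic (overlap U0 (U k)).
  exact: (unitary_doubly_stochastic U0u (Uu k)).
have mu0_gt0 i : 0 < mu0 0 i.
  rewrite mu0E; apply: convex_comb_gt0 => // k.
  have [D_ge0 rows _] := ds k; exact: convex_comb_gt0.
split=> //.
have ds0 : doubly_stochastic (overlap U0 V).
  exact: (unitary_doubly_stochastic U0u Vu).
(* The diagonal of [unitary_diag V y0] in the eigenbasis [U0] of the mixture. *)
pose y' := \row_i \sum_j overlap U0 V i j * y0 0 j.
pose z := map_mx (@expR R) y'.
have z_gt0 i : 0 < z 0 i by rewrite mxE expR_gt0.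
have [w' [_ w'P]] := psi_tangent z_gt0.
have [w'E w'sup _] := w'P.
apply: le_trans (log_tangent_schur psi_perm ds0 w'P); rewrite -/y' -/z w'E.
(* Now [z = mu0 b], and [mu0] is a mixture of the images of the [mu k] under doubly stochastic
   matrices ([mix]), so the transport inequalities for the single [k] add up. *)
pose b := \row_i (z 0 i / mu0 0 i).
have b_gt0 i : 0 < b 0 i by rewrite mxE divr_gt0.
have step k := log_tangent_transport psi_perm (ds k) (a_gt0 k) (proj1 (wP k)) b_gt0
  (proj2 (wP k)) w'sup (muE k).
have ln_b i : ln (b 0 i) = y' 0 i - ln (mu0 0 i).
  by rewrite mxE ln_div ?posrE // [z 0 i]mxE expRK.
have mix (f : 'I_n -> R) : \sum_i f i * mu0 0 i =
    \sum_k t k * \sum_i f i * \sum_j overlap U0 (U k) i j * mu k 0 j.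
  under [RHS]eq_bigr do rewrite mulr_sumr.
  rewrite exchange_big /=; apply: eq_bigr => i _; rewrite mu0E mulr_sumr.
  by apply: eq_bigr => k _; rewrite mulrCA.
have -> : \sum_i w' 0 i * z 0 i = \sum_i w' 0 i * b 0 i * mu0 0 i.
  by apply: eq_bigr => i _; rewrite [b _ _]mxE -mulrA divfK // gt_eqF.
have -> : retr (unitary_diag U0 mu0 *m unitary_diag V y0) - entropy_sum mu0 =
    \sum_i ln (b 0 i) * mu0 0 i.
  rewrite retr_mul_unitary_diag -sumrB; apply: eq_bigr => i _.
  rewrite ln_b mulrBl [y' 0 i]mxE mulr_suml [ln _ * _]mulrC; congr (_ - _).
  by apply: eq_bigr => j _; rewrite [overlap _ _ _ _]mxE; ring.
rewrite !mix -big_split; apply: ler_sum => k _ /=; rewrite -mulrDr.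
apply: ler_wpM2l; first exact: t_ge0.
apply: le_trans (step k); rewrite lerD2r -addrA lerD2l (retr_mul_same _ _ (Uu k)).
rewrite -sumrB; apply: ler_sum => i _.
by rewrite [in leRHS]mulrBr [a _ _ _]mxE expRK.
Qed.

Lemma form_mx_exp_diagonalization (Y : 'M[R[i]]_n) : Y \is hermsymmx ->
  exists U (y : 'rV[R]_n), [/\ U \is unitarymx, unitary_diag U y = Y
    & form_mx psi (mxexp Y) = psi (map_mx (@expR R) y)].
Proof.
move=> Yh; exists (spectralmx Y), (real_spectrum Y); split.
- exact: spectral_unitarymx.
- by rewrite -hermsymmx_spectral.
- exact: form_mx_exp.
Qed.

Lemma log_tangent_exp_concave (m : nat) (H : 'M[R[i]]_n) (p : 'I_m -> R)
    (I : finType) (t : I -> R) (A : I -> 'I_m -> 'M[R[i]]_n) (A0 : 'I_m -> 'M[R[i]]_n) :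
  H \is hermsymmx -> (forall j, 0 <= p j) -> \sum_(j < m) p j <= 1 ->
  (forall k, 0 <= t k) -> \sum_k t k = 1 ->
  (forall k j, posdefmx (A k j)) -> (forall j, posdefmx (A0 j)) ->
  (forall j, A0 j = \sum_k (t k)%:C *: A k j) ->
  \sum_k t k * form_mx psi (mxexp (H + \sum_(j < m) (p j)%:C *: mxlog (A k j))) <=
  form_mx psi (mxexp (H + \sum_(j < m) (p j)%:C *: mxlog (A0 j))).
Proof.
move=> Hh p_ge0 p_le1 t_ge0 t1 A_pos A0_pos A0E.
have logh B : mxlog B \is hermsymmx.
  by rewrite /mxlog spectral_funE; exact: unitary_diag_hermitian.
have Yh (B : 'I_m -> 'M[R[i]]_n) : H + \sum_(j < m) (p j)%:C *: mxlog (B j) \is hermsymmx.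
  by apply: hermsymmxD; [exact: Hh | apply: hermsymmx_lin => j; exact: logh].
have [U /choice[y Uy]] := choice (fun k => form_mx_exp_diagonalization (Yh (A k))).
have [V [y0 [Vu Vy0 Y0E]]] := form_mx_exp_diagonalization (Yh A0).
rewrite [leRHS]Y0E {Y0E}.
have Uu k : U k \is unitarymx by case: (Uy k).
have UyE k : unitary_diag (U k) (y k) = H + \sum_(j < m) (p j)%:C *: mxlog (A k j).
  by case: (Uy k).
have -> : \sum_k t k * form_mx psi (mxexp (H + \sum_(j < m) (p j)%:C *: mxlog (A k j))) =
    \sum_k t k * psi (map_mx (@expR R) (y k)).
  by apply: eq_bigr => k _; case: (Uy k) => _ _ ->.
have [mu [U0 [mu0 [U0u mu_gt0 mu0_gt0 ME]]]] := log_tangent_gibbs y y0 t_ge0 t1 Uu Vu.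
(* Consumes the bound of [log_tangent_gibbs]; what remains is that its entropic terms add up to
   something nonnegative. *)
apply: le_trans.
have [W /choice[b Wb]] := choice (fun j => posdefmx_log (A0_pos j)).
have [Wk /choice[bk Wbk]] := choice (fun kj => posdefmx_log (A_pos kj.1 kj.2)).
have RE j : entropy_sum mu0 - retr (unitary_diag U0 mu0 *m mxlog (A0 j)) <=
    \sum_k t k * (entropy_sum (mu k) - retr (unitary_diag (U k) (mu k) *m mxlog (A k j))).
  have [Wu b_gt0 WbE ->] := Wb j.
  rewrite -(relative_entropyE _ _ U0u Wu).
  have -> : \sum_k t k *
      (entropy_sum (mu k) - retr (unitary_diag (U k) (mu k) *m mxlog (A k j)))
      = \sum_k t k * relative_entropy (U k) (mu k) (Wk (k, j)) (bk (k, j)).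
    apply: eq_bigr => k _; have [Wku _ _ ->] := Wbk (k, j).
    by rewrite (relative_entropyE _ _ (Uu k) Wku).
  apply: (relative_entropy_convex t_ge0 Uu _ U0u Wu mu_gt0 _ mu0_gt0 b_gt0 ME).
  - by move=> k; case: (Wbk (k, j)).
  - by move=> k; case: (Wbk (k, j)).
  - by rewrite WbE A0E; apply: eq_bigr => k _; case: (Wbk (k, j)) => _ _ ->.
have SE := entropy_sum_convex t_ge0 t1 Uu U0u mu_gt0 mu0_gt0 ME.
(* Distributes the entropy [e]: a share [p j] forms a relative entropy with [B j], and the rest, of
   weight [1 - \sum_j p j >= 0], stays a plain entropy. The term in [H] is linear in [X] and cancels
   between the mixture and its components. *)
have retrE X (B : 'I_m -> 'M[R[i]]_n) e :
    e - retr (X *m (H + \sum_(j < m) (p j)%:C *: mxlog (B j))) =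
    (1 - \sum_(j < m) p j) * e - retr (X *m H) +
    \sum_(j < m) p j * (e - retr (X *m mxlog (B j))).
  rewrite retr_mulD; under [X in _ = _ + X]eq_bigr do rewrite mulrBr.
  rewrite sumrB -mulr_suml; ring.
have -> : \sum_k t k * (psi (map_mx (@expR R) (y k)) + entropy_sum (mu k) -
     retr (unitary_diag (U k) (mu k) *m unitary_diag (U k) (y k))) =
   \sum_k t k * psi (map_mx (@expR R) (y k)) +
   ((1 - \sum_(j < m) p j) * (\sum_k t k * entropy_sum (mu k)) -
    retr (unitary_diag U0 mu0 *m H) +
    \sum_(j < m) p j * \sum_k t k * (entropy_sum (mu k) -
       retr (unitary_diag (U k) (mu k) *m mxlog (A k j)))).
  have -> : \sum_(j < m) p j * \sum_k t k * (entropy_sum (mu k) -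
       retr (unitary_diag (U k) (mu k) *m mxlog (A k j))) =
     \sum_k t k * \sum_(j < m) p j * (entropy_sum (mu k) -
       retr (unitary_diag (U k) (mu k) *m mxlog (A k j))).
    under eq_bigr do rewrite mulr_sumr.
    rewrite exchange_big /=; apply: eq_bigr => k _; rewrite mulr_sumr.
    by apply: eq_bigr => j _; rewrite mulrCA.
  rewrite ME retr_mul_suml mulr_sumr -sumrB -!big_split /=.
  apply: eq_bigr => k _; rewrite -addrA UyE retrE; ring.
rewrite -addrA lerDl Vy0 -[X in _ + X]opprB retrE subr_ge0.
apply: lerD; last first.
  by apply: ler_sum => j _; apply: ler_wpM2l; [exact: p_ge0 | exact: RE].
rewrite lerD2r; apply: ler_wpM2l; last exact: SE.
by rewrite subr_ge0.
Qed.

End Core.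

(* Adding [e * \sum_i x 0 i] keeps all hypotheses and makes the gradient strictly
   positive, so that the matrices built from it are positive definite. *)
Section Perturbation.
Variables (R : realType) (n : nat) (phi : 'rV[R]_n -> R).
Hypotheses (phi_form : is_symmetric_form phi) (phi_hoelder : hoelder_form phi)
  (phi_concave : concave_form phi).

Lemma log_tangent_perturbed (e : R) (a : 'rV[R]_n) : 0 < e -> (forall i, 0 < a 0 i) ->
  exists w : 'rV[R]_n, (forall i, 0 < w 0 i) /\
    log_tangent (fun x => phi x + e * \sum_i x 0 i) a w.
Proof.
move=> e0 a_gt0.
have [w w_ge0 [wE wsup wsub]] := form_log_tangent phi_form phi_hoelder phi_concave a_gt0.
have wD c : \sum_i (w + const_mx e) 0 i * c 0 i = \sum_i w 0 i * c 0 i + e * \sum_i c 0 i.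
  by rewrite mulr_sumr -big_split; apply: eq_bigr => i _; rewrite !mxE mulrDl.
exists (w + const_mx e); split=> [i|]; first by rewrite !mxE ltr_wpDl.
split=> [|c c_ge0|c c_gt0]; first by rewrite wD wE.
  by rewrite wD lerD2r wsup.
have -> : \sum_i (w + const_mx e) 0 i * a 0 i * (ln (c 0 i) - ln (a 0 i)) =
    \sum_i w 0 i * a 0 i * (ln (c 0 i) - ln (a 0 i)) +
    e * \sum_i a 0 i * (ln (c 0 i) - ln (a 0 i)).
  by rewrite mulr_sumr -big_split; apply: eq_bigr => i _ /=; rewrite !mxE; ring.
(* The log-subgradient inequality for the sum of the entries, from [ln x <= x - 1] at
   [x = c_i / a_i]. *)
have ln_le : \sum_i a 0 i + \sum_i a 0 i * (ln (c 0 i) - ln (a 0 i)) <= \sum_i c 0 i.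
  rewrite -big_split; apply: ler_sum => i _ /=.
  rewrite -ln_div ?posrE // -[X in X + _]mulr1 -mulrDr.
  have ca : 0 < c 0 i / a 0 i by rewrite divr_gt0.
  have := @le_ln1Dx R (c 0 i / a 0 i - 1); rewrite subrKC => H.
  have {}H : 1 + ln (c 0 i / a 0 i) <= c 0 i / a 0 i by have := H; lra.
  by move: H; rewrite ler_pdivlMr // mulrC.
have := wsub c c_gt0; move: ln_le; rewrite -(ler_pM2l e0) mulrDr; lra.
Qed.

(** The perturbed inequality is affine in [e], with a slope [c] fixed by the three traces, so a
    small [e] makes the error at most any [d > 0]. *)
Lemma form_mx_concave_limit (t : R) (X1 X2 X0 : 'M[R[i]]_n) :
  (forall e, 0 < e -> let psi x := phi x + e * \sum_i x 0 i in
     t * form_mx psi X1 + (1 - t) * form_mx psi X2 <= form_mx psi X0) ->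
  t * form_mx phi X1 + (1 - t) * form_mx phi X2 <= form_mx phi X0.
Proof.
rewrite /form_mx /= => conc.
pose tr (Y : 'M[R[i]]_n) := \sum_i eigvals Y 0 i : R.
pose c := tr X0 - (t * tr X1 + (1 - t) * tr X2).
apply/ler_addgt0Pr => d d0.
have c1 : 0 < `|c| + 1 by rewrite ltr_wpDl.
pose e := d / (`|c| + 1).
have e0 : 0 < e by rewrite divr_gt0.
have ec : e * c <= d.
  rewrite /e mulrAC ler_pdivrMr // ler_pM2l //.
  by rewrite (le_trans (ler_norm _)) // lerDl.
have := conc e e0; rewrite -/(tr X0) -/(tr X1) -/(tr X2).
by move: ec; rewrite /c; lra.
Qed.

Lemma form_exp_log_concave (m : nat) (H : 'M[R[i]]_n) (p : 'I_m -> R) (t : R)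
    (A B A0 : 'I_m -> 'M[R[i]]_n) :
  H \is hermsymmx -> (forall j, 0 <= p j) -> \sum_(j < m) p j <= 1 -> 0 <= t <= 1 ->
  (forall j, posdefmx (A j)) -> (forall j, posdefmx (B j)) ->
  (forall j, A0 j = t%:C *: A j + (1 - t)%:C *: B j) ->
  t * form_mx phi (mxexp (H + \sum_(j < m) (p j)%:C *: mxlog (A j))) +
    (1 - t) * form_mx phi (mxexp (H + \sum_(j < m) (p j)%:C *: mxlog (B j))) <=
  form_mx phi (mxexp (H + \sum_(j < m) (p j)%:C *: mxlog (A0 j))).
Proof.
move=> Hh p_ge0 p_le1 t01 A_pos B_pos A0E.
have A0_pos j : posdefmx (A0 j) by rewrite A0E; exact: posdefmx_convex.
pose psi e (x : 'rV[R]_n) := phi x + e * \sum_i x 0 i.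
have psi_perm e (s : 'S_n) x : nneg_orthant x -> psi e (col_perm s x) = psi e x.
  move=> x_ge0; rewrite /psi (form_perm phi_form) //; congr (_ + _ * _).
  by rewrite [RHS](reindex_inj (@perm_inj _ s)); apply: eq_bigr => i _; rewrite mxE.
(* The two-point mixture as a family indexed by [bool]. *)
pose tt (b : bool) := if b then t else 1 - t.
have tt_ge0 b : 0 <= tt b by move: t01 => /andP[? ?]; case: b; rewrite ?subr_ge0.
have tt1 : \sum_b tt b = 1 by rewrite big_bool /= subrKC.
pose AB (b : bool) := if b then A else B.
have AB_pos b j : posdefmx (AB b j) by case: b.
have A0_AB j : A0 j = \sum_b (tt b)%:C *: AB b j by rewrite big_bool A0E.
have conc e (e0 : 0 < e) := log_tangent_exp_concave (psi_perm e)
  (fun a => log_tangent_perturbed e0 (a := a)) Hh p_ge0 p_le1 tt_ge0 tt1 AB_pos A0_pos A0_AB.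
apply: form_mx_concave_limit => e e0 /=.
by have := conc e e0; rewrite big_bool.
Qed.

End Perturbation.

Theorem theorem2p6 (R : realType) (n m : nat) (hn : (0 < n)%N) (hm : (0 < m)%N)
    (phi : 'rV[R]_n -> R) (phi_form : is_symmetric_form phi)
    (phi_hoelder : hoelder_form phi) (phi_concave : concave_form phi) :
  (forall (H : 'M[R[i]]_n) (p : 'I_m -> R), H \is hermsymmx ->
     (forall j, 0 < p j <= 1) -> \sum_(j < m) p j <= 1 ->
     concave_on [set A : {ffun 'I_m -> 'M[R[i]]_n} | forall j, posdefmx (A j)]
       (fun A => form_mx phi (mxexp (H + \sum_(j < m) (p j)%:C *: mxlog (A j)))))
  /\
  (forall H : 'M[R[i]]_n, H \is hermsymmx ->
     concave_on [set A : 'M[R[i]]_n | posdefmx A]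
       (fun A => form_mx phi (mxexp (H + mxlog A)))).
Proof.
split=> [H p Hh p01 p_le1 A B t A_pos B_pos t01 | H Hh A B t A_pos B_pos t01].
  apply: (form_exp_log_concave phi_form phi_hoelder phi_concave Hh _ p_le1 t01 A_pos B_pos).
    by move=> j; have /andP[/ltW] := p01 j.
  by move=> j; rewrite !ffunE.
(* The case of a single matrix with weight 1. *)
have := @form_exp_log_concave R n phi phi_form phi_hoelder phi_concave 1 H (fun=> 1) t
  (fun=> A) (fun=> B) (fun=> t%:C *: A + (1 - t)%:C *: B).
have one (L : 'M[R[i]]_n) : H + \sum_(j < 1) 1%:C *: L = H + L.
  by rewrite big_ord1 rmorph1 scale1r.
by rewrite (one (mxlog A)) (one (mxlog B)) (one (mxlog (_ + _))) big_ord1; apply.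
Qed.
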